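(* For every integer $n\geq 3$, as formal power series in $q_1,q_2$, $$HS_{\mathbf{q}}^n\langle2\omega_1,2\omega_2\rangle=\left(1+\frac{2}{n-2}\,q_2\frac{\partial}{\partial q_2}\right)\left(1+\frac{2}{n-1}\,q_1\frac{\partial}{\partial q_1}+\frac{2}{n-1}\,q_2\frac{\partial}{\partial q_2}\right)HS_{\mathbf{q}}^{n-1}\langle2\omega_1,2\omega_2\rangle,$$ where $HS_{\mathbf{q}}^{m}\langle2\omega_1,2\omega_2\rangle$ is the generating function, in the two variables $q_1,q_2$, of the dimensions of the irreducible representations of $SL(m,\mathbb{C})$ with highest weights $2a_1\omega_1+2a_2\omega_2$, $(a_1,a_2)\in\mathbb{N}^2$.
   Context: $\mathbb{N}$ includes $0$. For $m\geq 2$, let $\omega_1,\dots,\omega_{m-1}$ be the fundamental dominant weights of $SL(m,\mathbb{C})$ (with respect to the Borel subgroup of upper triangular matrices, in the standard order, so that $\omega_i$ is the highest weight of $\bigwedge^i\mathbb{C}^m$), and for a dominant integral weight $\lambda$ let $L(\lambda)$ be the finite-dimensional irreducible representation of $SL(m,\mathbb{C})$ with highest weight $\lambda$. Define $$HS_{\mathbf{q}}^{m}\langle2\omega_1,2\omega_2\rangle:=\sum_{(a_1,a_2)\in\mathbb{N}^2}\dim\bigl(L(2a_1\omega_1+2a_2\omega_2)\bigr)\,q_1^{a_1}q_2^{a_2},$$ where $\omega_1,\omega_2$ are the first two fundamental dominant weights of $SL(m,\mathbb{C})$. For $m=2$ (which occurs only on the right-hand side when $n=3$), use the convention $\omega_2=0$.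 The differential operators act on formal power series in $q_1,q_2$. *)

(* Defs.v *)
From mathcomp Require Import all_boot all_order all_algebra.
From mathcomp Require Import complex.
From mathcomp Require mpoly.
From mathcomp Require Import boolp classical_sets functions reals.

Set Implicit Arguments.
Unset Strict Implicit.
Unset Printing Implicit Defensive.

Import Order.TTheory GRing.Theory Num.Theory.

Local Open Scope ring_scope.

Section SpecialLinear.
Variables (R : realType) (m : nat).
Local Notation C := R[i].

Definition SL : {pred 'M[C]_m} := [pred A | \det A == 1].

(* The regular functions on SL(m, C) are the restrictions of the polynomials
   in the m * m matrix entries. *)
Definition regular_on_SL (f : 'M[C]_m -> C) : Prop :=
  exists P : mpoly.mpoly (m * m) C,
    forall A, A \in SL -> f A = mpoly.meval (fun k => mxvec A 0 k) P.

(* A finite-dimensional rational representation of SL(m, C) on V; only the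
   values of rho on SL matter. *)
Record is_rep (V : vectType C) (rho : 'M[C]_m -> 'End(V)) : Prop := IsRep {
  rep1 : rho 1%:M = \1%VF;
  repM : forall A B, A \in SL -> B \in SL ->
    rho (A *m B) = (rho A \o rho B)%VF;
  rep_regular : forall (phi : 'Hom(V, C^o)) (v : V),
    regular_on_SL (fun A => phi (rho A v))
}.

Definition irreducible_rep (V : vectType C) (rho : 'M[C]_m -> 'End(V)) : Prop :=
  [/\ is_rep rho,
      fullv != 0%VS :> {vspace V} &
      forall W : {vspace V},
        (forall A, A \in SL -> (rho A @: W <= W)%VS) ->
        W = 0%VS \/ W = fullv].

(* An integral weight is given by integers (lam_1, ..., lam_m), standing for
   the character diag(t_1, ..., t_m) |-> \prod_k t_k ^ lam_k of the diagonal
   torus of SL(m, C); tuples differing by a multiple of (1, ..., 1) represent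
   the same weight. *)

(* omega_i = (1, ..., 1, 0, ..., 0) with i ones, for 1 <= i < m; by convention
   omega_i = 0 for i >= m. *)
Definition omega (i : nat) : 'rV[int]_m := \row_(k < m) (k < i < m)%N%:Z.

(* The character lam of the torus, extended to upper triangular matrices. *)
Definition borel_char (lam : 'rV[int]_m) (B : 'M[C]_m) : C :=
  \prod_(k < m) B k k ^ lam 0 k.

(* rho has highest weight lam with respect to the Borel subgroup of upper
   triangular matrices (is_trig_mx means lower triangular). *)
Definition has_highest_weight (lam : 'rV[int]_m)
    (V : vectType C) (rho : 'M[C]_m -> 'End(V)) : Prop :=
  exists2 v : V, v != 0 &
    forall B, B \in SL -> is_trig_mx B^T -> rho B v = borel_char lam B *: v.

(* The dimension of L(lam), which is unique up to isomorphism; the default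
   value 0 is for weights that are not dominant. *)
Definition dimL (lam : 'rV[int]_m) : nat :=
  xget 0%N [set d | exists (V : vectType C) (rho : 'M[C]_m -> 'End(V)),
    [/\ irreducible_rep rho, has_highest_weight lam rho & \dim {:V} = d]].

End SpecialLinear.

(* Formal power series in q_1, q_2 with rational coefficients: F a1 a2 is the
   coefficient of q_1^a1 q_2^a2. *)
Definition fps2 : Type := nat -> nat -> rat.

Definition fps2_add (F G : fps2) : fps2 := fun a1 a2 => F a1 a2 + G a1 a2.

Definition fps2_scale (c : rat) (F : fps2) : fps2 := fun a1 a2 => c * F a1 a2.

Definition mulq1 (F : fps2) : fps2 :=
  fun a1 a2 => if a1 is b.+1 then F b a2 else 0.

Definition mulq2 (F : fps2) : fps2 :=
  fun a1 a2 => if a2 is b.+1 then F a1 b else 0.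

Definition dq1 (F : fps2) : fps2 := fun a1 a2 => a1.+1%:R * F a1.+1 a2.

Definition dq2 (F : fps2) : fps2 := fun a1 a2 => a2.+1%:R * F a1 a2.+1.

Declare Scope fps2_scope.
Delimit Scope fps2_scope with fps2.
Bind Scope fps2_scope with fps2.
Notation "F + G" := (fps2_add F G) : fps2_scope.
Notation "c *: F" := (fps2_scale c%R F) : fps2_scope.

Definition HS (R : realType) (m : nat) : fps2 :=
  fun a1 a2 =>
    (dimL R (omega m 1 *+ (2 * a1)%N + omega m 2 *+ (2 * a2)%N))%:R.

(* Main.v *)
(* Put p = 2 (a1 + a2) and q = 2 a2.  The representation with highest weight
   (p, q, 0, ..., 0) is realized on the polynomials P(x, y) in two vectors of C^m that are
   bihomogeneous of degree (p, q) and killed by E = sum_i x_i d/dy_i, i.e. satisfy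
   P(x, y + c x) = P(x, y), with g acting by P(x, y) |-> P(x g, y g).  Its highest weight
   vector is f = x_0^(p-q) (x_0 y_1 - x_1 y_0)^q.  A nonzero invariant subspace contains an
   element not vanishing at (e0, e1); its component of the weight of f under a one-parameter
   torus is a nonzero multiple of f.  So f lies in every nonzero invariant subspace, and the
   orthogonal of the orbit of f for Fischer's bilinear form, being invariant and not
   containing f, is zero: the representation is irreducible.  By the sl2 relations E is
   surjective, which gives the dimension
     C(p+m-1, p) C(q+m-1, q) - C(p+m, p+1) C(q+m-2, q-1)
       = (p-q+1)/(p+1) C(p+m-1, p) C(q+m-2, q),
   whose dependence on m is the stated recurrence.

   The dimension depends only on the weight: on an irreducible representation with highest
   weight vector v there is a functional phi with phi(n v) = 1 for all lower unipotent n, and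
   g |-> phi(g v) is determined by the weight on the lower-upper products, which are dense in
   SL.  Hence the linear relations between the vectors g v depend only on the weight. *)
From HB Require Import structures.
Require Import Defs.
From mathcomp Require Import all_boot all_order all_algebra.
From mathcomp Require Import complex mpoly reals.
From mathcomp Require boolp.
From mathcomp Require Import ring lra zify.

Set Implicit Arguments.
Unset Strict Implicit.
Unset Printing Implicit Defensive.

Import Order.TTheory GRing.Theory Num.Theory.

Local Open Scope ring_scope.

(** * Polynomial functions *)

Section PolynomialFunctions.
Variable F : numFieldType.

Lemma poly_fun_eq0 (Q : {poly F}) : (forall t, Q.[t] = 0) -> Q = 0.
Proof.
move=> Q0; apply: (@roots_geq_poly_eq0 _ Q [seq i%:R | i <- iota 0 (size Q)]).
- by apply/allP => x _; rewrite /root Q0.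
- by rewrite map_inj_uniq ?iota_uniq // => i j /eqP; rewrite eqr_nat => /eqP.
- by rewrite size_map size_iota.
Qed.

(** The product [Q * D] vanishes at every point, and the polynomial ring is a domain. *)
Lemma poly_fun_eq0_on (D Q : {poly F}) : D != 0 ->
  (forall t, D.[t] != 0 -> Q.[t] = 0) -> Q = 0.
Proof.
move=> D0 QD; suff /eqP : Q * D = 0 by rewrite mulf_eq0 (negPf D0) orbF => /eqP.
apply: poly_fun_eq0 => t; rewrite hornerM.
by have [->|/QD->] := eqVneq D.[t] 0; rewrite ?mulr0 ?mul0r.
Qed.

Lemma poly_fun_eq0_unit (Q : {poly F}) : (forall t, t != 0 -> Q.[t] = 0) -> Q = 0.
Proof.
move=> Q0; apply: (@poly_fun_eq0_on 'X); first by rewrite polyX_eq0.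
by move=> t; rewrite hornerX; apply: Q0.
Qed.

(** Uniqueness of base [N] digits: reduction modulo [N] isolates the lowest digit, and induction
    handles the quotient. *)
Lemma digits_inj N n (a b : 'I_n -> nat) :
  (forall i, a i < N)%N -> (forall i, b i < N)%N ->
  (\sum_i a i * N ^ i = \sum_i b i * N ^ i)%N -> a =1 b.
Proof.
elim: n a b => [|n IH] a b aN bN; first by move=> _ [].
have N0 : (0 < N)%N by apply: leq_ltn_trans (aN ord0).
have shift (c : 'I_n.+1 -> nat) :
    (\sum_i c i * N ^ i = (\sum_i c (lift ord0 i) * N ^ i) * N + c ord0)%N.
  rewrite big_ord_recl expn0 muln1 addnC; congr (_ + _)%N.
  by rewrite big_distrl /=; apply: eq_bigr => i _; rewrite expnS; lia.
rewrite !shift => E.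
have E0 : a ord0 = b ord0.
  by move: (congr1 (modn^~ N) E); rewrite !modnMDl !modn_small.
have /IH H : (\sum_i a (lift ord0 i) * N ^ i = \sum_i b (lift ord0 i) * N ^ i)%N.
  by move: E; rewrite E0 => /eqP; rewrite eqn_add2r eqn_pmul2r // => /eqP.
move=> i; have [j ->|->//] := unliftP ord0 i.
by apply: H => k.
Qed.

(* Kronecker substitution: v_i = t ^ (N ^ i) sends the monomials of p to distinct powers of t. *)
Lemma mpoly_fun_eq0 n (p : {mpoly F[n]}) : (forall v, p.@[v] = 0) -> p = 0.
Proof.
move=> p0; set N := msize p.
pose code (m : 'X_{1..n}) := (\sum_i m i * N ^ i)%N.
have code_inj m m' : m \in msupp p -> m' \in msupp p -> code m = code m' -> m = m'.
  have small k : k \in msupp p -> forall i, (k i < N)%N.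
    move=> /msize_mdeg_lt kN i; apply: leq_ltn_trans kN.
    by rewrite mdegE (bigD1 i) //= leq_addr.
  by move=> hm hm' /(digits_inj (small _ hm) (small _ hm')) E; apply/mnmP.
have Q0 : \sum_(m <- msupp p) p@_m *: 'X^(code m) = 0 :> {poly F}.
  apply: poly_fun_eq0 => t; rewrite -[RHS](p0 (fun i => t ^+ (N ^ i))) mevalE.
  rewrite horner_sum; apply: eq_bigr => m _.
  rewrite hornerZ hornerXn -prodrXr; congr (_ * _); apply: eq_bigr => i _.
  by rewrite -exprM mulnC.
apply/mpolyP => m; rewrite mcoeff0; case: (boolP (m \in msupp p)) => [hm|]; last first.
  by rewrite -mcoeff_eq0 => /eqP.
have := congr1 (fun q : {poly F} => q`_(code m)) Q0.
rewrite coef0 coef_sum (bigD1_seq m) ?msupp_uniq //= coefZ coefXn eqxx mulr1.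
rewrite big1_seq ?addr0 // => m' /andP[ne hm'].
rewrite coefZ coefXn; case: eqP => [/code_inj E|]; last by rewrite mulr0.
by rewrite (E hm hm') eqxx in ne.
Qed.

Lemma mpoly_fun_inj n (p q : {mpoly F[n]}) : (forall v, p.@[v] = q.@[v]) -> p = q.
Proof.
move=> E; apply/eqP; rewrite -subr_eq0; apply/eqP/mpoly_fun_eq0 => v.
by rewrite mevalB E subrr.
Qed.

End PolynomialFunctions.

(** The chain rule for an abstract derivation killing the constants. The polynomials satisfying it
    contain 1 and the variables and are closed under products and linear combinations. It serves
    both for curves and for composition. *)
Lemma derivation_mmap (A S : comNzRingType) n (f : {rmorphism A -> S}) (h : 'I_n -> S)
    (D : {additive S -> S}) (p : {mpoly A[n]}) :
  (forall a b, D (a * b) = D a * b + a * D b) -> (forall c, D (f c) = 0) ->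
  D (mmap f h p) = \sum_i mmap f h p^`M(i) * D (h i).
Proof.
move=> DM Df.
pose good (q : {mpoly A[n]}) := D (mmap f h q) = \sum_i mmap f h q^`M(i) * D (h i).
have good1 : good 1.
  rewrite /good -mpolyC1 mmapC Df big1 // => i _.
  by rewrite mderivC mmap0 mul0r.
have goodM q r : good q -> good r -> good (q * r).
  rewrite /good => Hq Hr; rewrite rmorphM /= DM Hq Hr mulr_suml mulr_sumr.
  rewrite -big_split /=; apply: eq_bigr => i _.
  by rewrite mderivM mmapD !rmorphM /=; ring.
have goodX i : good 'X_i.
  rewrite /good mmapX mmap1U (bigD1 i) //= mderivX mnm1E eqxx scale1r.
  have -> : (U_(i) - U_(i))%MM = 0%MM :> 'X_{1..n}.
    by apply/mnmP => j; rewrite mnmBE subnn mnm0E.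
  rewrite mpolyX0 rmorph1 mul1r big1 ?addr0 // => j ne.
  by rewrite mderivX mnm1E eq_sym (negPf ne) scale0r mmap0 mul0r.
have goodXm m : good 'X_[m].
  rewrite mpolyXE_id; apply: (big_ind good) => // i _.
  by elim: (m i) => [|k IH]; rewrite ?expr0 // exprS; apply: goodM.
rewrite -/(good p) [p]mpolyE; apply: (big_ind good).
- by rewrite /good mmap0 raddf0 big1 // => i _; rewrite mderiv0 mmap0 mul0r.
- move=> q r; rewrite /good => Hq Hr.
  rewrite mmapD raddfD /= Hq Hr -big_split; apply: eq_bigr => i _.
  by rewrite mderivD mmapD mulrDl.
- move=> m _; have := goodXm m; rewrite /good => H.
  rewrite mmapZ DM Df mul0r add0r H mulr_sumr; apply: eq_bigr => i _.
  by rewrite mderivZ mmapZ mulrA.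
Qed.

Section PolynomialCurves.
Variables (F : comNzRingType) (n : nat).
Implicit Types (p : {mpoly F[n]}) (h : 'I_n -> {poly F}).

Lemma horner_mmap p h t :
  (mmap polyC h p).[t] = p.@[fun i => (h i).[t]].
Proof.
rewrite mevalE /mmap horner_sum; apply: eq_bigr => m _.
rewrite hornerM hornerC horner_prod; congr (_ * _).
by apply: eq_bigr => i _; rewrite horner_exp.
Qed.

Lemma deriv_mmap p h :
  (mmap polyC h p)^`() = \sum_i mmap polyC h p^`M(i) * (h i)^`().
Proof. exact: (derivation_mmap h p (@derivM _) (@derivC _)). Qed.

Lemma mderiv_comp_mpoly k p (lq : n.-tuple {mpoly F[k]}) (i : 'I_k) :
  (p \mPo lq)^`M(i) = \sum_j (p^`M(j) \mPo lq) * (tnth lq j)^`M(i).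
Proof. exact: (derivation_mmap (tnth lq) p (mderivM i) (@mderivC _ _ i)). Qed.

End PolynomialCurves.

(** Every monomial of [p] has degree below [msize p], so this power of [d] clears all denominators
    at once. *)
Lemma meval_clear_denominators (F : fieldType) n (p : {mpoly F[n]})
    (b : 'I_n -> {poly F}) (d : {poly F}) :
  exists (k : nat) (Q : {poly F}), forall t, d.[t] != 0 ->
    Q.[t] = d.[t] ^+ k * p.@[fun i => (b i).[t] / d.[t]].
Proof.
exists (msize p).
exists (\sum_(m <- msupp p)
  p@_m *: ((\prod_i b i ^+ m i) * d ^+ (msize p - mdeg m))) => t dt.
rewrite horner_sum mevalE mulr_sumr !big_seq; apply: eq_bigr => m hm.
have lt : (mdeg m <= msize p)%N by apply/ltnW/msize_mdeg_lt.
rewrite hornerZ hornerM horner_prod horner_exp.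
under [in RHS]eq_bigr do rewrite expr_div_n.
rewrite big_split /= -[X in d.[t] ^+ X](subnK lt) exprD.
have -> : \prod_i (d.[t] ^+ m i)^-1 = (d.[t] ^+ mdeg m)^-1.
  by rewrite prodfV prodrXr mdegE.
under eq_bigr do rewrite horner_exp.
have : d.[t] ^+ mdeg m != 0 by rewrite expf_neq0.
move: (d.[t] ^+ mdeg m) (d.[t] ^+ (_ - _)) (\prod_i _) => u v w u0.
by field.
Qed.

(* Iterated Schur complements without division: a polynomial in the entries
   whose nonvanishing allows Gaussian elimination without pivoting. *)
Fixpoint pivot_product (A : comNzRingType) m : 'M[A]_m -> A :=
  match m with
  | 0 => fun _ => 1
  | k.+1 => fun g : 'M[A]_(1 + k) => g 0 0 *
      pivot_product (g 0 0 *: drsubmx g - dlsubmx g *m ursubmx g)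
  end.

Lemma pivot_product1 (A : comNzRingType) m : pivot_product (1%:M : 'M[A]_m) = 1.
Proof.
elim: m => // m IH /=; rewrite -[1%:M in LHS]/(1%:M : 'M_(1 + m)).
by rewrite scalar_mx_block block_mxKdr block_mxKdl block_mxKur mul0mx subr0
   -scalar_mx_block mxE eqxx scale1r IH mulr1.
Qed.

Lemma map_pivot_product (A B : comNzRingType) (f : {rmorphism A -> B}) m (g : 'M[A]_m) :
  pivot_product (map_mx f g) = f (pivot_product g).
Proof.
elim: m g => [|m IH] g /=; first by rewrite rmorph1.
rewrite rmorphM -IH mxE map_mxB map_mxZ map_mxM.
by rewrite map_drsubmx map_dlsubmx map_ursubmx.
Qed.

Definition lower_unipotent (A : nzRingType) m (g : 'M[A]_m) :=
  is_trig_mx g && [forall i, g i i == 1].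

Lemma lower_unipotent1 (A : nzRingType) m : lower_unipotent (1%:M : 'M[A]_m).
Proof.
by rewrite /lower_unipotent scalar_mx_is_trig; apply/forallP => i; rewrite mxE eqxx.
Qed.

Lemma det_lower_unipotent (A : comNzRingType) m (g : 'M[A]_m) :
  lower_unipotent g -> \det g = 1.
Proof.
by case/andP=> /det_trig-> /forallP g1; rewrite big1 // => i _; apply/eqP.
Qed.

Lemma gauss_without_pivoting (F : fieldType) m (g : 'M[F]_m) :
  pivot_product g != 0 ->
  exists L U, [/\ lower_unipotent L, is_trig_mx U^T & g = L *m U].
Proof.
elim: m g => [|m IH] g.
  by exists 1%:M, 1%:M; rewrite lower_unipotent1 trmx1 scalar_mx_is_trig; split=> //;
     apply/matrixP => [] [].
rewrite -[m.+1]/(1 + m)%N in g * => /=; rewrite mulf_eq0 negb_or => /andP[a0].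
set a := g 0 0 in a0 *; case/IH=> L [U [/andP[Ltrig /forallP L1] Utrig E]].
have ga : ulsubmx g = a%:M.
  by apply/matrixP=> i j; rewrite !ord1 !mxE eqxx mulr1n; congr (g _ _); apply: val_inj.
(* The induction hypothesis factors [a] times the Schur complement, hence the factor [a^-1] on the
   block [U] of the upper factor. *)
exists (block_mx 1%:M 0 (a^-1 *: dlsubmx g) L).
exists (block_mx a%:M (ursubmx g) 0 (a^-1 *: U)); split.
- apply/andP; split; first by rewrite is_trig_block_mx // eqxx Ltrig scalar_mx_is_trig.
  apply/forallP => i; rewrite -(splitK i); case: (split i) => k /=.
    by rewrite block_mxEul mxE eqxx.
  by rewrite block_mxEdr.
- rewrite tr_block_mx trmx0 is_trig_block_mx // eqxx tr_scalar_mx scalar_mx_is_trig /=.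
  rewrite linearZ /=; apply/is_trig_mxP => i j ij.
  by rewrite mxE (is_trig_mxP Utrig _ _ ij) mulr0.
- rewrite mulmx_block !mul1mx !mul0mx mulmx0 !addr0 -ga -scalemxAr -E.
  rewrite -[LHS]submxK; congr block_mx.
    by rewrite ga mul_mx_scalar scalerA mulfV ?scale1r.
  by rewrite scalerBr scalerA mulVf ?scale1r // -scalemxAl addrC subrK.
Qed.

(** * Density of the lower-upper products in SL *)

Section BigCell.
Variables (R : realType) (m : nat).
Local Notation C := R[i].

(* Scaling the first column of (1 - t) A + t by the inverse of its determinant
   gives a rational curve in SL from A to 1; it meets the set of the products
   L U for all but finitely many t. *)
Lemma regular_eq0 (f : 'M[C]_m.+1 -> C) : regular_on_SL f ->
  (forall L U, lower_unipotent L -> U \in @SL R m.+1 -> is_trig_mx U^T ->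
     f (L *m U) = 0) ->
  forall A, A \in @SL R m.+1 -> f A = 0.
Proof.
case=> P fP f0 A; rewrite inE => /eqP detA.
pose G : 'M[{poly C}]_m.+1 := (1 - 'X) *: map_mx polyC A + 'X%:M.
pose d := \det G.
have GtE t : map_mx (horner_eval t) G = (1 - t) *: A + t%:M.
  apply/matrixP => i j; rewrite !mxE /horner_eval hornerD hornerM hornerD hornerN.
  by rewrite !hornerC hornerMn !hornerX.
have dt t : d.[t] = \det ((1 - t) *: A + t%:M).
  by rewrite -GtE det_map_mx.
have pt t : (pivot_product G).[t] = pivot_product ((1 - t) *: A + t%:M).
  by rewrite -GtE map_pivot_product.
have d0 : d.[0] = 1 by rewrite dt subr0 scale1r raddf0 addr0.
pose D t : 'M[C]_m.+1 := diag_mx (\row_j if j == 0 then (d.[t])^-1 else 1).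
have detD t : \det (D t) = (d.[t])^-1.
  rewrite det_diag (bigD1 0) //= mxE eqxx big1 ?mulr1 // => i ne.
  by rewrite mxE (negPf ne).
pose curve t := ((1 - t) *: A + t%:M) *m D t.
(* Numerators of the entries of [curve] over the common denominator [d]; only the first column is
   really divided by [d]. *)
pose b k := mxvec (\matrix_(i, j) if j == 0 then G i j else d * G i j) 0 k.
have curveE t : d.[t] != 0 -> (fun k => mxvec (curve t) 0 k) =1 (fun k => (b k).[t] / d.[t]).
  move=> d0t k; case/mxvec_indexP: k => i j; rewrite /b !mxvecE /curve -GtE.
  rewrite mul_mx_diag !mxE /horner_eval.
  by case: ifP => // _; rewrite hornerM mulr1 mulrAC divff ?mul1r.
have curveSL t : d.[t] != 0 -> curve t \in @SL R m.+1.
  by move=> d0t; rewrite inE det_mulmx detD -dt mulfV.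
have [k [Q QE]] := meval_clear_denominators P b d.
have Q0 : Q = 0.
  (* The excluded parameters are the roots of a nonzero polynomial: [d] is 1 at 0, where the curve
     is at [A], and the pivot product is 1 at 1, where [G] is the identity. *)
  apply: (@poly_fun_eq0_on _ (d * pivot_product G)).
    rewrite mulf_eq0 negb_or; apply/andP; split; apply/eqP => E.
      by move: d0; rewrite E horner0 => /eqP; rewrite eq_sym oner_eq0.
    move: (pt 1); rewrite E horner0 subrr scale0r add0r pivot_product1 => /eqP.
    by rewrite eq_sym oner_eq0.
  move=> t; rewrite hornerM mulf_eq0 negb_or pt => /andP[d0t].
  case/gauss_without_pivoting => L [U [hL hU E]].
  rewrite QE // -(meval_eq _ (curveE t d0t)) -fP ?curveSL //.
  (* The diagonal matrix is absorbed into the upper triangular factor, which then has determinant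
     1. *)
  rewrite /curve E -mulmxA f0 ?mulr0 //.
    by have := curveSL t d0t; rewrite inE /curve E -mulmxA det_mulmx det_lower_unipotent ?mul1r.
  rewrite trmx_mul tr_diag_mx mul_diag_mx; apply/is_trig_mxP => i j ij.
  by rewrite !mxE; move/is_trig_mxP: hU => /(_ _ _ ij); rewrite mxE => ->; rewrite mulr0.
have := QE 0; rewrite d0 oner_neq0 Q0 horner0 expr1n mul1r => /(_ isT).
have := curveE 0; rewrite d0 oner_neq0 => /(_ isT) H; rewrite -(meval_eq _ H) -fP.
  move/esym; congr (f _ = 0); rewrite /curve subr0 scale1r raddf0 addr0.
  rewrite /D d0 invr1; have -> : (\row_j (if j == 0 then 1 else 1)) = const_mx 1 :> 'rV[C]_m.+1.
    by apply/rowP => j; rewrite !mxE if_same.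
  by rewrite diag_const_mx mulmx1.
by apply: curveSL; rewrite d0 oner_neq0.
Qed.

End BigCell.

(** * Uniqueness of the highest weight representation *)

Section VectorSpaces.
Variables (K : fieldType) (vT : vectType K).

(** A free family that does not yet generate can be extended by one vector; [grow] iterates this,
    and the dimension bounds the length. *)
Lemma free_generating_family (T : choiceType) (f : T -> vT) (P : {pred T}) :
  exists s : seq T, [/\ {subset s <= P}, free (map f s) &
    forall x, x \in P -> f x \in <<map f s>>%VS].
Proof.
suff grow k : exists s : seq T, [/\ {subset s <= P}, free (map f s) &
    (forall x, x \in P -> f x \in <<map f s>>%VS) \/ (k <= size s)%N].
  have [s [sP sf [sx|]]] := grow (\dim {:vT}).+1; first by exists s.
  rewrite -(size_map f) -(eqP (sf : \dim _ == _)) ltnNge dimvS ?subvf //.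
elim: k => [|k [s [sP sf [sx|ks]]]].
- by exists [::]; split=> //; [exact: nil_free | right].
- by exists s; split=> //; left.
have [sx|] := boolp.pselect (forall x, x \in P -> f x \in <<map f s>>%VS).
  by exists s; split=> //; left.
move=> /boolp.existsNP[x /boolp.not_implyP[xP /negP fx]].
exists (x :: s); split; rewrite /= ?free_cons ?fx //; last by right.
by move=> y; rewrite inE => /predU1P[->|/sP].
Qed.

(** The map [q] kills [U] but not [v], so some coordinate of [q v] is nonzero; that coordinate
    composed with [q] is normalized. *)
Lemma separating_functional (U : {vspace vT}) (v : vT) : v \notin U ->
  exists phi : 'Hom(vT, K^o), phi v = 1 /\ forall u, u \in U -> phi u = 0.
Proof.
move=> vU; pose q : 'End(vT) := (\1 - projv U)%VF.
have qv : q v != 0.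
  rewrite add_lfunE opp_lfunE id_lfunE subr_eq0.
  by apply: contraNneq vU => ->; rewrite memv_proj.
have [i ci] : exists i, coord (vbasis {:vT}) i (q v) != 0.
  apply/existsP; apply: contraNT qv; rewrite negb_exists => /forallP c0.
  rewrite (coord_vbasis (memvf (q v))) big1 // => i _.
  by have /negPn/eqP-> := c0 i; rewrite scale0r.
set c := coord _ _ _ in ci.
exists (c^-1 *: (linfun (coord (vbasis {:vT}) i : vT -> K^o) \o q)%VF); split.
  by rewrite scale_lfunE comp_lfunE lfunE /= -/c; apply: mulVf.
move=> u uU; rewrite scale_lfunE comp_lfunE.
by rewrite (add_lfunE \1%VF) opp_lfunE id_lfunE projv_id // subrr !linear0.
Qed.

End VectorSpaces.

Section HighestWeight.
Variables (R : realType) (m : nat).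
Local Notation C := R[i].
Local Notation SL := (@SL R m.+1).
Implicit Types (V : vectType C) (g L B : 'M[C]_m.+1).

Lemma SL1 : 1%:M \in SL.
Proof. by rewrite inE det1. Qed.

Lemma SLM A B : A \in SL -> B \in SL -> A *m B \in SL.
Proof. by rewrite !inE det_mulmx => /eqP-> /eqP->; rewrite mulr1. Qed.

Lemma lower_unipotent_SL L : lower_unipotent L -> L \in SL.
Proof. by move=> hL; rewrite inE det_lower_unipotent. Qed.

Lemma regularB (f f' : 'M[C]_m.+1 -> C) :
  regular_on_SL f -> regular_on_SL f' -> regular_on_SL (fun A => f A - f' A).
Proof.
by move=> [P fP] [P' fP']; exists (P - P') => A hA; rewrite mevalB fP ?fP'.
Qed.

(** The conjugate of a lower triangular [L] by diag(1, X, ..., X^m). The subtraction truncates only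
    above the diagonal, where such an [L] is zero. Being polynomial in the parameter, it also makes
    sense at 0, where the torus element degenerates. *)
Definition contraction L : 'M[{poly C}]_m.+1 := \matrix_(i, j) (L i j *: 'X^(i - j)).

Lemma contraction0 L : lower_unipotent L ->
  map_mx (horner_eval 0) (contraction L) = 1%:M.
Proof.
case/andP=> /is_trig_mxP Ltrig /forallP L1; apply/matrixP => i j.
rewrite !mxE /horner_eval hornerZ hornerXn.
have [ij|ji|ij] := ltngtP i j.
- by rewrite Ltrig // mul0r; case: eqP ij => // ->; rewrite ltnn.
- by rewrite expr0n subn_eq0 leqNgt ji mulr0; case: eqP ji => // ->; rewrite ltnn.
- by rewrite (val_inj ij) subnn mulr1 eqxx (eqP (L1 j)).
Qed.

(** An (m+1)-th root of the determinant exists in the algebraically closed field; dividing by it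
    makes the determinant 1. *)
Lemma scaled_torus_SL (s : C) : s != 0 ->
  exists2 c, c != 0 & c *: diag_mx (\row_(i < m.+1) s ^+ i) \in SL.
Proof.
move=> s0; set D := diag_mx _.
have detD0 : \det D != 0.
  by rewrite det_diag prodf_seq_neq0; apply/allP => i _; rewrite mxE expf_neq0.
have [c cE] : exists c, c ^+ m.+1 = \det D.
  by exists (m.+1.-root (\det D)); rewrite rootCK.
have c0 : c != 0 by apply: contraNneq detD0 => c0; rewrite -cE c0 expr0n.
by exists c^-1; rewrite ?invr_eq0 // inE detZ -cE -exprMn mulVf // expr1n.
Qed.

Lemma contraction_torus (s : C) : s != 0 -> exists T T', [/\ T \in SL, T' \in SL, is_trig_mx T'^T &
   forall L, lower_unipotent L -> T *m L *m T' = map_mx (horner_eval s) (contraction L)].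
Proof.
move=> s0; have [c c0 TSL] := scaled_torus_SL s0.
set T := c *: _ in TSL.
have TE : T = diag_mx (\row_(i < m.+1) (c * s ^+ i)).
  by apply/matrixP => i j; rewrite !mxE mulrnAr.
pose T' := diag_mx (\row_(i < m.+1) (c * s ^+ i)^-1).
have TT' : T *m T' = 1%:M.
  rewrite TE mul_diag_mx; apply/matrixP => i j; rewrite !mxE.
  case: eqP => [->|_]; last by rewrite mulr0.
  by rewrite !mulr1n mulfV // mulf_neq0 ?expf_neq0.
exists T, T'; split=> //.
- have := congr1 determinant TT'; rewrite det_mulmx det1.
  by move: TSL; rewrite !inE => /eqP->; rewrite mul1r => ->.
- by rewrite tr_diag_mx diag_mx_is_trig.
move=> L /andP[/is_trig_mxP Ltrig _]; rewrite TE mul_diag_mx mul_mx_diag.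
apply/matrixP => i j; rewrite !mxE /horner_eval hornerZ hornerXn.
have [ij|ji] := ltnP i j; first by rewrite Ltrig // mulr0 !mul0r.
rewrite -{1}(subnK ji) exprD.
have sj : s ^+ j != 0 by rewrite expf_neq0.
by move: (s ^+ j) (s ^+ (i - j)) sj => u w u0; field; rewrite u0 c0.
Qed.

Section OneRepresentation.
Variables (V : vectType C) (rho : 'M[C]_m.+1 -> 'End(V)).
Hypothesis rhoP : is_rep rho.

Lemma rep_mul g h w : g \in SL -> h \in SL -> rho (g *m h) w = rho g (rho h w).
Proof. by move=> hg hh; rewrite (repM rhoP) // comp_lfunE. Qed.

Lemma rep_one w : rho 1%:M w = w.
Proof. by rewrite (rep1 rhoP) id_lfunE. Qed.

(** The span of the orbit of [w] is invariant and contains [w], so it is everything. *)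
Lemma orbit_basis w : irreducible_rep rho -> w != 0 ->
  exists gs, [/\ {subset gs <= SL}, free [seq rho g w | g <- gs] &
     <<[seq rho g w | g <- gs]>>%VS = fullv].
Proof.
case=> _ _ irr w0.
have [gs [gsSL gsf gsx]] := free_generating_family (fun g => rho g w) SL.
exists gs; split=> //; set W := <<_>>%VS.
have WSL A : A \in SL -> (rho A @: W <= W)%VS.
  move=> ASL; rewrite limg_span; apply/span_subvP => u /mapP[_ /mapP[g hg ->] ->].
  by rewrite -rep_mul ?gsx ?SLM // gsSL.
have [W0|//] := irr W WSL.
by have := gsx _ SL1; rewrite rep_one -/W W0 memv0 (negPf w0).
Qed.

Variables (lam : 'rV[int]_m.+1) (v : V).
Hypothesis irr : irreducible_rep rho.
Hypothesis v0 : v != 0.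
Hypothesis vlam : forall B, B \in SL -> is_trig_mx B^T -> rho B v = borel_char lam B *: v.

(** A functional killing [U] kills [rho (L *m B) v], a multiple of [rho L v]. By density it kills
    the whole orbit of [v], which spans. *)
Lemma lower_orbit_generates (U : {vspace V}) :
  (forall L, lower_unipotent L -> rho L v \in U) -> U = fullv.
Proof.
move=> UL; apply/vspaceP => w; rewrite memvf; apply/negPn/negP.
case/separating_functional => psi [psiw psiU].
have psi0 : forall A, A \in SL -> psi (rho A v) = 0.
  apply: regular_eq0; first exact: (rep_regular rhoP).
  move=> L B hL hB Btrig; rewrite rep_mul ?(lower_unipotent_SL hL) // (vlam hB Btrig).
  by rewrite !linearZ /= (psiU _ (UL _ hL)) scaler0.
have [gs [gsSL _ gsV]] := orbit_basis irr v0.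
have : w \in <<[seq rho g v | g <- gs]>>%VS by rewrite gsV memvf.
rewrite -[X in <<X>>%VS]in_tupleE => /coord_span E.
move: psiw; rewrite E linear_sum big1 ?[X in X = _]/(0 : C) => [/eqP|i _].
  by rewrite eq_sym oner_eq0.
rewrite linearZ /= (nth_map 0) ?psi0; first by rewrite scaler0.
- by apply/gsSL/mem_nth; rewrite -(size_map (fun g => rho g v)).
- by rewrite -(size_map (fun g => rho g v)).
Qed.

(* Conjugating by the torus contracts the lower unipotent group to 1. *)
Lemma lower_orbit_relation k (c : 'I_k -> C) (n : 'I_k -> 'M[C]_m.+1) L :
  (forall i, lower_unipotent (n i)) -> lower_unipotent L ->
  rho L v = \sum_i c i *: rho (n i) v -> \sum_i c i = 1.
Proof.
move=> nP LP E.
have v0' : v \notin 0%VS by rewrite memv0.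
have [psi [psiv _]] := separating_functional v0'.
have [P PE] := rep_regular rhoP psi v.
pose Q g := mmap polyC (fun k => mxvec (contraction g) 0 k) P.
have QE g s : map_mx (horner_eval s) (contraction g) \in SL ->
   (Q g).[s] = psi (rho (map_mx (horner_eval s) (contraction g)) v).
  move=> hg; rewrite /Q horner_mmap PE //; apply: meval_eq => l.
  by case/mxvec_indexP: l => i j; rewrite !mxvecE [RHS]mxE.
clearbody Q.
(* For [s] nonzero, [(Q g).[s]] is a fixed linear functional of [rho g v], because [T'] acts on [v]
   by a scalar; the relation [E] therefore passes to the [Q]. *)
have Q0 (s : C) : s != 0 -> (Q L - \sum_i c i *: Q (n i)).[s] = 0.
  move=> s0.
  have [T [T' [TSL T'SL T'trig TE]]] := contraction_torus s0.
  have QT g : lower_unipotent g -> (Q g).[s] = borel_char lam T' * psi (rho T (rho g v)).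
    move=> hg; have gSL := lower_unipotent_SL hg.
    rewrite QE -TE ?SLM // !rep_mul ?SLM // vlam //.
    by rewrite !linearZ.
  rewrite hornerD hornerN horner_sum QT // E 2!linear_sum mulr_sumr.
  rewrite -sumrB big1 // => i _; rewrite hornerZ QT // 2!linearZ /=.
  by rewrite /GRing.scale /=; ring.
(* At 0 every lower unipotent matrix is contracted to the identity, and [psi v = 1]. *)
have Q10 g : lower_unipotent g -> (Q g).[0] = 1.
  by move=> hg; rewrite QE contraction0 ?SL1 // rep_one.
have := congr1 (horner^~ 0) (poly_fun_eq0_unit Q0).
rewrite hornerD hornerN horner_sum horner0 Q10 //.
move/eqP; rewrite subr_eq0 => /eqP ->; apply: eq_bigr => i _.
by rewrite hornerZ Q10 // mulr1.
Qed.

(** Take a basis inside the lower unipotent orbit and let [phi] be the sum of the coordinates;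
    [lower_orbit_relation] gives the value 1. *)
Lemma lower_invariant_functional : exists phi : 'Hom(V, C^o),
  forall L, lower_unipotent L -> phi (rho L v) = 1.
Proof.
have [ns [nsP _ nsx]] := free_generating_family (fun g => rho g v) [pred g | lower_unipotent g].
have nsV := lower_orbit_generates nsx.
pose X := in_tuple [seq rho g v | g <- ns].
exists (\sum_i linfun (coord X i : V -> C^o)) => L hL.
rewrite sum_lfunE; under eq_bigr do rewrite lfunE /=.
apply: (@lower_orbit_relation _ _ (fun i => nth 0 ns i) L) => //.
  move=> i; apply/nsP/mem_nth.
  by rewrite -(size_map (fun g => rho g v)).
rewrite {1}(coord_span (X := X) (v := rho L v)) ?nsV ?memvf //.
by apply: eq_bigr => i _; rewrite (nth_map 0) // -(size_map (fun g => rho g v)).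
Qed.

End OneRepresentation.

(** A basis of [V] in the orbit of [v] is matched with vectors in the orbit of [v'], and these are
    shown to be free. *)
Lemma highest_weight_dim_le lam (V V' : vectType C)
    (rho : 'M[C]_m.+1 -> 'End(V)) (rho' : 'M[C]_m.+1 -> 'End(V')) :
  irreducible_rep rho -> has_highest_weight lam rho ->
  irreducible_rep rho' -> has_highest_weight lam rho' ->
  (\dim {:V} <= \dim {:V'})%N.
Proof.
move=> irr [v v0 vlam] irr' [v' v'0 v'lam].
have [[rP _ _] [rP' _ _]] := (irr, irr').
have [phi phi1] := lower_invariant_functional rP irr v0 vlam.
have [phi' phi'1] := lower_invariant_functional rP' irr' v'0 v'lam.
(* On a product [L *m B] both sides equal [borel_char lam B]; density extends the equality to SL. *)
have phiE A : A \in SL -> phi (rho A v) = phi' (rho' A v').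
  move=> ASL; apply/eqP; rewrite -subr_eq0; apply/eqP.
  pose f A := phi (rho A v) - phi' (rho' A v').
  apply: (@regular_eq0 R m f) ASL; first exact: regularB (rep_regular rP _ _) (rep_regular rP' _ _).
  move=> L B hL hB Btrig; rewrite /f (rep_mul rP) ?(rep_mul rP') ?(lower_unipotent_SL hL) //.
  rewrite vlam // v'lam // !linearZ /= phi1 // phi'1 //. by rewrite scalerN subrr.
have [gs [gsSL gsf gsV]] := orbit_basis rP irr v0.
have sz : size gs = \dim {:V} by rewrite -gsV (eqP (gsf : \dim _ == _)) size_map.
pose X := in_tuple [seq rho g v | g <- gs].
pose X' := map_tuple (fun g => rho' g v') (in_tuple gs).
suff X'f : free X'.
  by rewrite -sz -(size_tuple X') -(eqP (X'f : \dim _ == _)) dimvS ?subvf.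
apply/freeP => k k0.
have gSL (i : 'I_(size gs)) : nth 0 gs i \in SL by apply/gsSL/mem_nth.
pose w := \sum_(i < size gs) k i *: rho (nth 0 gs i) v.
have phiw A : A \in SL -> phi (rho A w) = 0.
  move=> ASL; rewrite -[RHS](linear0 phi') -[in RHS](linear0 (rho' A)) -k0.
  rewrite !linear_sum; apply: eq_bigr => i _; rewrite !linearZ /=.
  by rewrite (nth_map 0) // -(rep_mul rP) // -(rep_mul rP') // phiE ?SLM.
(* Otherwise the orbit of [w] would span [V], and [phi], which kills this orbit, would vanish at
   [v]. *)
have /eqP w0 : w == 0.
  apply/negPn/negP => w0; have [hs [hsSL _ hsV]] := orbit_basis rP irr w0.
  pose Y := in_tuple [seq rho g w | g <- hs].
  have /coord_span vE : v \in <<Y>>%VS by rewrite hsV memvf.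
  have := phi1 _ (lower_unipotent1 _ _); rewrite (rep_one rP) vE linear_sum big1 => [/eqP|i _].
    by rewrite eq_sym oner_eq0.
  have hi : (i < size hs)%N by rewrite -(size_map (fun g => rho g w)).
  by rewrite linearZ /= (nth_map 0) // phiw ?scaler0 //; apply/hsSL/mem_nth.
have /freeP : free (map_tuple (fun g => rho g v) (in_tuple gs)) := gsf.
move=> /(_ k) H; apply: H; rewrite -[RHS]w0; apply: eq_bigr => i _.
by rewrite (nth_map 0).
Qed.

Lemma dimL_eq lam (V : vectType C) (rho : 'M[C]_m.+1 -> 'End(V)) :
  irreducible_rep rho -> has_highest_weight lam rho -> dimL R lam = \dim {:V}.
Proof.
move=> irr hw; rewrite /dimL.
case: classical_sets.xgetP => [d _ [V' [rho' [irr' hw' <-]]]|/(_ (\dim {:V}))[]].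
  by apply/eqP; rewrite eqn_leq (highest_weight_dim_le irr hw irr' hw')
     (highest_weight_dim_le irr' hw' irr hw).
by exists V, rho.
Qed.

End HighestWeight.

(** * Polarization and the sl2 relations *)

Section Polarization.
Variables (K : numFieldType) (N m : nat).
Implicit Types (u w : 'I_m -> 'I_N) (p : {mpoly K[N]}) (mu : 'X_{1..N}).

Definition polarize u w p := \sum_i 'X_(u i) * p^`M(w i).

Fact polarize_linear u w : linear (polarize u w).
Proof.
move=> c p q; rewrite /polarize scaler_sumr -big_split; apply: eq_bigr => i _.
by rewrite mderivD mderivZ mulrDr scalerAr.
Qed.

HB.instance Definition _ u w :=
  GRing.isLinear.Build K {mpoly K[N]} {mpoly K[N]} _ (polarize u w) (polarize_linear u w).

Definition vdeg u mu := (\sum_i mu (u i))%N.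

Definition vhomog u d p := {in msupp p, forall mu, vdeg u mu = d}.

Lemma vhomogP u d p : vhomog u d p <-> forall mu, vdeg u mu != d -> p@_mu = 0.
Proof.
split=> H mu; first by apply: contraNeq; rewrite -mcoeff_msupp => /H->.
by rewrite mcoeff_msupp => h; apply/eqP; apply: contraNT h => /H->.
Qed.

Lemma vhomog0 u d : vhomog u d 0.
Proof. by move=> mu; rewrite msupp0. Qed.

Lemma vhomogD u d p q : vhomog u d p -> vhomog u d q -> vhomog u d (p + q).
Proof.
rewrite !vhomogP => hp hq mu h; by rewrite mcoeffD hp ?hq ?addr0.
Qed.

Lemma vhomogZ u d c p : vhomog u d p -> vhomog u d (c *: p).
Proof. by rewrite !vhomogP => hp mu h; rewrite mcoeffZ hp ?mulr0. Qed.

Lemma vdegD u mu nu : vdeg u (mu + nu) = (vdeg u mu + vdeg u nu)%N.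
Proof. by rewrite /vdeg -big_split; apply: eq_bigr => i _; rewrite mnmDE. Qed.


Lemma vhomogX u mu : vhomog u (vdeg u mu) 'X_[mu].
Proof. by move=> nu; rewrite msuppX inE => /eqP->. Qed.

Lemma vhomog_sum u d (I : eqType) (r : seq I) (G : I -> {mpoly K[N]}) :
  {in r, forall i, vhomog u d (G i)} -> vhomog u d (\sum_(i <- r) G i).
Proof.
move=> hG; rewrite big_seq; apply: (big_ind (vhomog u d)) => //.
- exact: vhomog0.
- by move=> p q; apply: vhomogD.
Qed.

Lemma vdeg_mnm_sub v mu i : (mu i != 0)%N ->
  vdeg v mu = (vdeg v (mu - U_(i)) + vdeg v U_(i))%N.
Proof. by move=> mi; rewrite -vdegD submK // lep1mP. Qed.

Lemma polarizeE u w p : polarize u w p =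
  \sum_(mu <- msupp p) p@_mu *:
    (\sum_i (mu (w i))%:R *: 'X_[U_(u i) + (mu - U_(w i))]).
Proof.
rewrite {1}[p]mpolyE linear_sum; apply: eq_bigr => mu _; rewrite linearZ /=.
by congr (_ *: _); apply: eq_bigr => i _; rewrite mderivX -scalerAr -mpolyXD.
Qed.

Lemma vhomog_polarize u w v d e p : vhomog v d p ->
  (forall i, (d > 0) || (vdeg v U_(w i) == 0) -> vdeg v U_(u i) + d = e + vdeg v U_(w i))%N ->
  vhomog v e (polarize u w p).
Proof.
move=> hp de; rewrite polarizeE; apply: vhomog_sum => mu hmu; apply: vhomogZ.
apply: vhomog_sum => i _; have [->|mi] := eqVneq (mu (w i)) 0%N.
  by rewrite scale0r; apply: vhomog0.
apply: vhomogZ => nu; rewrite msuppX inE => /eqP->; rewrite vdegD.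
have := vdeg_mnm_sub v mi; rewrite (hp _ hmu); have := de i; lia.
Qed.

Lemma polarize_deg0 u w p : vhomog w 0 p -> polarize u w p = 0.
Proof.
move=> hp; rewrite polarizeE big1_seq // => mu /hp; rewrite /vdeg => /eqP.
rewrite sum_nat_eq0 => /forallP mu0; rewrite big1 ?scaler0 // => i _.
by rewrite (eqP (mu0 i)) scale0r.
Qed.

Lemma euler_identity u d p : vhomog u d p -> polarize u u p = d%:R *: p.
Proof.
move=> hp; rewrite polarizeE [in RHS](mpolyE p) scaler_sumr !big_seq.
apply: eq_bigr => mu /hp <-; rewrite scalerA mulrC -scalerA; congr (_ *: _).
rewrite /vdeg natr_sum scaler_suml; apply: eq_bigr => i _.
have [->|mi] := eqVneq (mu (u i)) 0%N; first by rewrite !scale0r.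
by rewrite addmC submK // lep1mP.
Qed.

(** The second-order terms of the two compositions agree by symmetry of mixed derivatives; the
    first-order terms are the two Euler operators. This is the relation [E, F] = H of sl2. *)
Lemma polarize_commutator u w p : injective u -> injective w -> (forall i j, u i != w j) ->
  polarize u w (polarize w u p) =
  polarize w u (polarize u w p) + (polarize u u p - polarize w w p).
Proof.
move=> ui wi uw.
have expand (a b : 'I_m -> 'I_N) : injective b ->
    (forall i j, a i != b j) ->
    polarize a b (polarize b a p) = polarize a a p +
    \sum_i \sum_j 'X_(a i) * 'X_(b j) * p^`M(a j)^`M(b i).
  move=> bi ab; rewrite /polarize -big_split; apply: eq_bigr => i _ /=.
  rewrite linear_sum mulr_sumr /=.
  under eq_bigr => j _ do rewrite mderivM mulrDr mulrA.
  rewrite big_split /=; congr (_ + _).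
  rewrite (bigD1 i) //= big1 => [|j ne].
    rewrite addr0 mderivX mnm1E eqxx scale1r.
    have -> : (U_(b i) - U_(b i))%MM = 0%MM :> 'X_{1..N}.
      by apply/mnmP => k; rewrite mnmBE subnn mnm0E.
    by rewrite mpolyX0 mul1r.
  by rewrite mderivX mnm1E (inj_eq bi) (negPf ne) scale0r mul0r mulr0.
rewrite (expand u w) // (expand w u) //; last by move=> i j; rewrite eq_sym.
rewrite exchange_big /=.
under eq_bigr do under eq_bigr do rewrite (mulrC 'X_(u _)) mderiv_comm.
by ring.
Qed.

Lemma vdeg_self u i : injective u -> vdeg u U_(u i) = 1%N.
Proof.
move=> ui; rewrite /vdeg (bigD1 i) //= mnm1E eqxx big1 // => j ne.
by rewrite mnm1E (inj_eq ui) eq_sym (negPf ne).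
Qed.

Lemma vdeg_other u w i : (forall i j, u i != w j) -> vdeg u U_(w i) = 0%N.
Proof. by move=> uw; rewrite /vdeg big1 // => j _; rewrite mnm1E eq_sym (negPf (uw _ _)). Qed.

End Polarization.

Section SL2.
Variables (K : numFieldType) (N m : nat) (u w : 'I_m -> 'I_N).
Hypotheses (ui : injective u) (wi : injective w) (uw : forall i j, u i != w j).
Implicit Types p : {mpoly K[N]}.

Definition bihom a b p := vhomog u a p /\ vhomog w b p.

Let wu i j : w i != u j. Proof. by rewrite eq_sym. Qed.

Lemma bihomD a b p q : bihom a b p -> bihom a b q -> bihom a b (p + q).
Proof. by move=> [? ?] [? ?]; split; apply: vhomogD. Qed.

Lemma bihomZ a b c p : bihom a b p -> bihom a b (c *: p).
Proof. by move=> [? ?]; split; apply: vhomogZ. Qed.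

Lemma bihom_raise a b p : bihom a b p -> bihom a.+1 b.-1 (polarize u w p).
Proof.
case=> ha hb; split; apply: vhomog_polarize; try eassumption.
  by move=> i _; rewrite vdeg_self // vdeg_other // addn0.
by move=> i; rewrite vdeg_self // vdeg_other //; lia.
Qed.

Lemma bihom_lower a b p : bihom a b p -> bihom a.-1 b.+1 (polarize w u p).
Proof.
case=> ha hb; split; apply: vhomog_polarize; try eassumption.
  by move=> i; rewrite vdeg_self // vdeg_other //; lia.
by move=> i _; rewrite vdeg_self // vdeg_other // addn0.
Qed.

Lemma raise_lower a b p : bihom a b p ->
  polarize u w (polarize w u p) =
  polarize w u (polarize u w p) + (a%:R - b%:R) *: p.
Proof.
by case=> ha hb; rewrite polarize_commutator // (euler_identity ha) (euler_identity hb) scalerBl.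
Qed.

Lemma bihom_raise_iter a b k p : bihom a b p -> bihom (a + k) (b - k) (iter k (polarize u w) p).
Proof.
move=> hp; elim: k => [|k IH]; first by rewrite addn0 subn0.
by rewrite addnS subnS; apply: bihom_raise.
Qed.

Lemma raise_iter_eq0 a b k p : bihom a b p -> (b < k)%N -> iter k (polarize u w) p = 0.
Proof.
move=> hp; elim: k => // k IH; rewrite ltnS leq_eqVlt => /predU1P[E|/IH] /=; last first.
  by move=> ->; rewrite linear0.
by apply: polarize_deg0; have [_] := bihom_raise_iter k hp; rewrite E subnn.
Qed.

(** The sl2 identity E^(k+1) F = F E^(k+1) + (k+1)(H + k) E^k on a vector of weight [a - b]. *)
Lemma raise_iter_lower a b k p : bihom a b p ->
  iter k.+1 (polarize u w) (polarize w u p) =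
  polarize w u (iter k.+1 (polarize u w) p) +
  (k.+1%:R * (a%:R - b%:R + k%:R)) *: iter k (polarize u w) p.
Proof.
move=> hp; elim: k => [|k IH]; first by rewrite /= (raise_lower hp) mul1r addr0.
rewrite iterS IH linearD linearZ [iter k.+2 _ p]iterS.
move: (bihom_raise_iter k.+1 hp) (@raise_iter_eq0 a b k.+1 p hp) (iterS k (polarize u w) p).
move: (iter k.+1 _ p) => r hr r0 rE /=.
rewrite -rE (raise_lower hr) -addrA -scalerDl.
(* If [k.+1] exceeds [b], the degree [b - k.+1] is truncated, but the iterate is then zero. *)
have [kb|bk] := leqP k.+1 b; last by rewrite (r0 bk) !scaler0.
by congr (_ + _ *: _); rewrite natrD natrB //; rewrite -!natr1; ring.
Qed.

(* Induction on the nilpotency order k: raising the lowered p gives a nonzero multiple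
   of p up to an element of smaller order. *)
Lemma raise_surjective a b p : (b < a)%N -> bihom a b p ->
  exists2 q, bihom a.-1 b.+1 q & polarize u w q = p.
Proof.
move=> ab hp; have := raise_iter_eq0 hp (ltnSn b); move: {1}b.+1 => k.
elim: k p hp => [|k IH] p hp /=.
  by move=> ->; exists 0; [split; apply: vhomog0 | rewrite linear0].
(* The coefficient from [raise_iter_lower], positive because [b < a]. *)
move=> Ek; pose c : K := k.+1%:R * (a%:R - b%:R + k%:R).
have c0 : c != 0.
  rewrite mulf_neq0 ?pnatr_eq0 //; apply: lt0r_neq0.
  by rewrite ltr_wpDr ?ler0n // subr_gt0 ltr_nat.
have hup : bihom a b (polarize u w (polarize w u p)).
  have := bihom_raise (bihom_lower hp); rewrite /=.
  by case: (a) ab.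
have hr0 : bihom a b (polarize u w (polarize w u p) - c *: p).
  by rewrite -scaleNr; apply: bihomD => //; apply: bihomZ.
have iterB (x y : {mpoly K[N]}) : iter k (polarize u w) (x - y) =
    iter k (polarize u w) x - iter k (polarize u w) y.
  by elim: k {IH Ek c c0 hr0} => //= k ->; rewrite linearB.
have iterZ x : iter k (polarize u w) (c *: x) = c *: iter k (polarize u w) x.
  by elim: k {IH Ek iterB} c {c0 hr0} => //= k IHk d; rewrite IHk linearZ.
have [|r hr Er] := IH _ hr0.
  by rewrite iterB iterZ -iterSr (raise_iter_lower k hp) iterS Ek linear0 add0r subrr.
exists (c^-1 *: (polarize w u p - r)).
  apply: bihomZ; rewrite -[- r]scaleN1r; apply: bihomD; last exact: bihomZ.
  exact: bihom_lower.
by rewrite linearZ linearB /= Er opprB addrC subrK scalerA mulVf // scale1r.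
Qed.

End SL2.

(** * Monomial coordinates and the model space *)

Section Coordinates.
Variables (K : fieldType) (N : nat) (s : seq 'X_{1..N}).

Definition mpoly_of_coords (c : 'rV[K]_(size s)) : {mpoly K[N]} :=
  \sum_i c 0 i *: 'X_[nth 0%MM s i].

Definition coords_of_mpoly (p : {mpoly K[N]}) : 'rV[K]_(size s) :=
  \row_i p@_(nth 0%MM s i).

Fact mpoly_of_coords_linear : linear mpoly_of_coords.
Proof.
move=> a c d; rewrite /mpoly_of_coords scaler_sumr -big_split.
by apply: eq_bigr => i _; rewrite !mxE scalerDl scalerA.
Qed.

HB.instance Definition _ := GRing.isLinear.Build K 'rV[K]_(size s) {mpoly K[N]} _
  mpoly_of_coords mpoly_of_coords_linear.

Fact coords_of_mpoly_linear : linear coords_of_mpoly.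
Proof. by move=> a p q; apply/rowP => i; rewrite !mxE mcoeffD mcoeffZ. Qed.

HB.instance Definition _ := GRing.isLinear.Build K {mpoly K[N]} 'rV[K]_(size s) _
  coords_of_mpoly coords_of_mpoly_linear.

Hypothesis us : uniq s.

Lemma mpoly_of_coordsK : cancel mpoly_of_coords coords_of_mpoly.
Proof.
move=> c; apply/rowP => i; rewrite mxE raddf_sum (bigD1 i) //=.
rewrite mcoeffZ mcoeffX eqxx mulr1 big1 ?addr0 // => j ne.
by rewrite mcoeffZ mcoeffX nth_uniq // (inj_eq val_inj) (negPf ne) mulr0.
Qed.

Lemma msupp_mpoly_of_coords c : {subset msupp (mpoly_of_coords c) <= s}.
Proof.
move=> mu; rewrite mcoeff_msupp; apply: contraNT => mus.
rewrite raddf_sum /= big1 // => i _; rewrite mcoeffZ mcoeffX.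
by case: eqP mus => [<-|]; rewrite ?mulr0 // mem_nth.
Qed.

Lemma coords_of_mpolyK p : {subset msupp p <= s} -> mpoly_of_coords (coords_of_mpoly p) = p.
Proof.
move=> ps; rewrite /mpoly_of_coords.
transitivity (\sum_(mu <- s) p@_mu *: 'X_[mu]).
  by rewrite (big_nth 0%MM) big_mkord; apply: eq_bigr => i _; rewrite mxE.
apply/mpolyP => mu; rewrite raddf_sum /=.
have [mus|mus] := boolP (mu \in s).
  rewrite (bigD1_seq mu) //= mcoeffZ mcoeffX eqxx mulr1 big1 ?addr0 // => nu ne.
  by rewrite mcoeffZ mcoeffX (negPf ne) mulr0.
rewrite big1_seq => [|nu /= nus].
  by apply/esym/eqP; rewrite mcoeff_eq0; apply: contra mus; apply: ps.
by rewrite mcoeffZ mcoeffX; case: eqP mus => [<-|]; rewrite ?nus ?mulr0.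
Qed.

End Coordinates.

Section Bimonomials.
Variable m : nat.
Local Notation xv := (@lshift m m).
Local Notation yv := (@rshift m m).

Lemma xv_inj : injective xv. Proof. exact: lshift_inj. Qed.
Lemma yv_inj : injective yv. Proof. exact: rshift_inj. Qed.
Lemma xv_neq_yv i j : xv i != yv j. Proof. by rewrite eq_lrshift. Qed.

Definition mnm_join (a b : 'X_{1..m}) : 'X_{1..m + m} :=
  [multinom (match split i with inl j => a j | inr j => b j end) | i < m + m].

Lemma mnm_joinl a b i : mnm_join a b (xv i) = a i.
Proof. by rewrite mnmE -[lshift m i]/(unsplit (inl i)) unsplitK. Qed.

Lemma mnm_joinr a b i : mnm_join a b (yv i) = b i.
Proof. by rewrite mnmE -[rshift m i]/(unsplit (inr i)) unsplitK. Qed.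

Definition monomials d : seq 'X_{1..m} := [seq s2m t | t : d.-tuple 'I_m <- enum (basis m d)].

Definition bimonomials p q :=
  [seq mnm_join a b | a <- monomials p, b <- monomials q].

Lemma bimonomials_uniq p q : uniq (bimonomials p q).
Proof.
apply: allpairs_uniq; [exact: uniq_basis | exact: uniq_basis |].
move=> [a b] [a' b'] _ _ /= E; congr pair; apply/mnmP => i.
  by rewrite -(mnm_joinl a b) E mnm_joinl.
by rewrite -(mnm_joinr a b) E mnm_joinr.
Qed.

Lemma mem_bimonomials p q mu :
  (mu \in bimonomials p q) = (vdeg xv mu == p) && (vdeg yv mu == q).
Proof.
apply/allpairsP/andP => [[[a b] /= []]|[dp dq]].
  rewrite -!basis_cover !mdegE => /eqP <- /eqP <- ->; rewrite /vdeg; split.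
    by apply/eqP/eq_bigr => i _; rewrite mnm_joinl.
  by apply/eqP/eq_bigr => i _; rewrite mnm_joinr.
exists ([multinom mu (xv i) | i < m], [multinom mu (yv i) | i < m]); rewrite /= -!basis_cover.
split; rewrite ?mdegE -?(eqP dp) -?(eqP dq).
- by apply/eqP/eq_bigr => i _; rewrite mnmE.
- by apply/eqP/eq_bigr => i _; rewrite mnmE.
apply/mnmP => i; rewrite -(splitK i); case: (split i) => j /=.
  by rewrite mnm_joinl mnmE.
by rewrite mnm_joinr mnmE.
Qed.

Lemma bihom_subset (K : numFieldType) p q (P : {mpoly K[m + m]}) :
  bihom xv yv p q P <-> {subset msupp P <= bimonomials p q}.
Proof.
split=> [[hx hy] mu hmu|H]; first by rewrite mem_bimonomials hx ?hy ?eqxx.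
by split=> mu /H; rewrite mem_bimonomials => /andP[/eqP ? /eqP ?].
Qed.

End Bimonomials.

Lemma size_bimonomials m p q :
  size (bimonomials m.+1 p q) = ('C(p + m, p) * 'C(q + m, q))%N.
Proof. by rewrite size_allpairs !size_basis. Qed.

Section ModelSpace.
Variables (K : numFieldType) (m p q : nat).
Local Notation xv := (@lshift m m).
Local Notation yv := (@rshift m m).
Local Notation E := (polarize xv yv : {mpoly K[m + m]} -> {mpoly K[m + m]}).
Local Notation mons := (bimonomials m).
Local Notation W p q := 'rV[K]_(size (mons p q)).

(** Coordinate vectors replace polynomials so that the kernel lives in a finite-dimensional
    space. *)
Definition raise_coords : W p q -> W p.+1 q.-1 :=
  @coords_of_mpoly K (m + m) (mons p.+1 q.-1) \o E \o @mpoly_of_coords K (m + m) (mons p q).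

Definition model_space : {vspace W p q} := lker (linfun raise_coords).

Lemma bihom_mpoly_of_coords (c : W p q) : bihom xv yv p q (mpoly_of_coords c).
Proof. by apply/bihom_subset/msupp_mpoly_of_coords. Qed.

Lemma mem_model_space c : (c \in model_space) = (E (mpoly_of_coords c) == 0).
Proof.
rewrite memv_ker lfunE /raise_coords /=; apply/eqP/eqP => [H|->]; last by rewrite linear0.
rewrite -[LHS](coords_of_mpolyK (@bimonomials_uniq m p.+1 q.-1)) ?H ?linear0 //.
by apply/bihom_subset/bihom_raise/bihom_mpoly_of_coords;
  [exact: xv_inj|exact: yv_inj|exact: xv_neq_yv].
Qed.

(** Rank-nullity: for positive [q] the operator is onto by [raise_surjective], as [q.-1 < p.+1]; for
    [q = 0] it is zero, hence the factor [(0 < q)]. *)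
Lemma dim_model_space : (q <= p)%N ->
  (\dim model_space + (0 < q) * size (mons p.+1 q.-1) = size (mons p q))%N.
Proof.
move=> qp; have := limg_ker_dim (linfun raise_coords) fullv.
rewrite capfv dimvf /dim /= mul1n => H; rewrite -[RHS]H; congr (_ + _)%N.
case: (posnP q) => q0.
  apply/eqP; rewrite eq_sym mul0n dimv_eq0 -subv0; apply/subvP => _ /memv_imgP[c _ ->].
  rewrite lfunE /raise_coords /= polarize_deg0 ?linear0 ?memv0 //.
  by have [_ h] := bihom_mpoly_of_coords c => mu /h ->.
suff -> : limg (linfun raise_coords) = fullv by rewrite dimvf /dim /= !mul1n.
apply/vspaceP => d; rewrite memvf; apply/memv_imgP.
have [|r hr Er] := raise_surjective (@xv_inj m) (@yv_inj m) (@xv_neq_yv m) _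
   (proj2 (bihom_subset _ _ _) (@msupp_mpoly_of_coords K _ (mons p.+1 q.-1) d)).
  by lia.
exists (coords_of_mpoly (mons p q) r); first exact: memvf.
rewrite lfunE /raise_coords /= coords_of_mpolyK ?bimonomials_uniq //.
  by rewrite Er mpoly_of_coordsK ?bimonomials_uniq.
by apply/bihom_subset; move: hr; rewrite /= prednK.
Qed.

End ModelSpace.

(** * Linear substitutions and Fischer's form *)

Section LinearSubstitution.
Variables (K : numFieldType) (N : nat).
Implicit Types (G H : 'M[K]_N) (P Q : {mpoly K[N]}) (v : 'rV[K]_N).

Lemma mpoly_row_inj P Q : (forall v, P.@[v 0] = Q.@[v 0]) -> P = Q.
Proof.
move=> E; apply: mpoly_fun_inj => v.
have vE : v =1 (\row_i v i) 0 by move=> i; rewrite mxE.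
by rewrite !(meval_eq _ vE).
Qed.

Definition linear_forms G : N.-tuple {mpoly K[N]} :=
  [tuple \sum_k G k i *: 'X_k | i < N].

Definition lsubst G P := P \mPo linear_forms G.

Fact lsubst_linear G : linear (lsubst G).
Proof. by move=> c p q; rewrite /lsubst linearP. Qed.

HB.instance Definition _ G := GRing.isLinear.Build K {mpoly K[N]} {mpoly K[N]} _
  (lsubst G) (lsubst_linear G).

Lemma lsubst_eval G P v : (lsubst G P).@[v 0] = P.@[(v *m G) 0].
Proof.
rewrite comp_mpoly_meval; apply: meval_eq => i.
rewrite tnth_mktuple raddf_sum mxE; apply: eq_bigr => k _ /=.
by rewrite mevalZ mevalXU mulrC.
Qed.

Lemma lsubstM G P Q : lsubst G (P * Q) = lsubst G P * lsubst G Q.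
Proof. exact: rmorphM. Qed.

Lemma lsubst1 G : lsubst G 1 = 1.
Proof. exact: rmorph1. Qed.

Lemma lsubstX G i : lsubst G 'X_i = \sum_k G k i *: 'X_k.
Proof. by rewrite /lsubst comp_mpolyXU -tnth_nth tnth_mktuple. Qed.

Lemma lsubst_diag (d : 'rV[K]_N) P : lsubst (diag_mx d) P =
  \sum_(mu <- msupp P) (P@_mu * \prod_i d 0 i ^+ mu i) *: 'X_[mu].
Proof.
apply: mpoly_row_inj => v; rewrite lsubst_eval mevalE raddf_sum.
apply: eq_bigr => mu _ /=; rewrite mevalZ mevalX -mulrA -big_split /=; congr (_ * _).
by apply: eq_bigr => i _; rewrite mul_mx_diag mxE mulrC exprMn.
Qed.

Lemma mcoeff_lsubst_diag (d : 'rV[K]_N) P mu :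
  (lsubst (diag_mx d) P)@_mu = P@_mu * \prod_i d 0 i ^+ mu i.
Proof.
rewrite lsubst_diag raddf_sum /=; have [h|h] := boolP (mu \in msupp P).
  rewrite (bigD1_seq mu) //= mcoeffZ mcoeffX eqxx mulr1 [X in _ + X]big1 ?addr0 // => nu ne.
  by rewrite mcoeffZ mcoeffX (negPf ne) mulr0.
rewrite big1_seq => [|nu /= hnu]; first by move: h; rewrite -mcoeff_eq0 => /eqP->; rewrite mul0r.
by rewrite mcoeffZ mcoeffX; case: eqP h => [<-|]; rewrite ?hnu ?mulr0.
Qed.

Lemma mderiv_lsubst G Q i :
  (lsubst G Q)^`M(i) = \sum_j G i j *: lsubst G Q^`M(j).
Proof.
rewrite /lsubst mderiv_comp_mpoly; apply: eq_bigr => j _.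
have -> : (tnth (linear_forms G) j)^`M(i) = (G i j)%:MP; last by rewrite mulrC mul_mpolyC.
rewrite tnth_mktuple linear_sum (bigD1 i) //= big1 => [|k ne].
  rewrite addr0 mderivZ mderivX mnm1E eqxx scale1r.
  have -> : (U_(i) - U_(i))%MM = 0%MM :> 'X_{1..N}.
    by apply/mnmP => k; rewrite mnmBE subnn mnm0E.
  by rewrite mpolyX0 alg_mpolyC.
by rewrite mderivZ mderivX mnm1E (negPf ne) scale0r scaler0.
Qed.

(* Fischer's bilinear form, for which multiplication by a variable is adjoint to
   the corresponding partial derivative. *)
Definition fischer Q P := \sum_(mu <- msupp Q) (Q@_mu * (\prod_i (mu i)`!)%:R) * P@_mu.

Fact fischer_linear Q : linear (fischer Q : {mpoly K[N]} -> K^o).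
Proof.
move=> c p q; rewrite /fischer scaler_sumr -big_split; apply: eq_bigr => mu _ /=.
by rewrite mcoeffD mcoeffZ /GRing.scale /=; ring.
Qed.

HB.instance Definition _ Q := GRing.isLinear.Build K {mpoly K[N]} K^o _
  (fischer Q) (fischer_linear Q).

Lemma fischerX Q mu : fischer Q 'X_[mu] = (\prod_i (mu i)`!)%:R * Q@_mu.
Proof.
rewrite /fischer; have [hmu|hmu] := boolP (mu \in msupp Q).
  rewrite (bigD1_seq mu) //= mcoeffX eqxx mulr1 mulrC [X in _ + X]big1 ?addr0 // => nu ne.
  by rewrite mcoeffX eq_sym (negPf ne) mulr0.
rewrite big1_seq => [|nu /= hnu].
  by move: hmu; rewrite -mcoeff_eq0 => /eqP ->; rewrite mulr0.
by rewrite mcoeffX; case: eqP hmu => [->|]; rewrite ?hnu ?mulr0.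
Qed.

Lemma fischer_sym P Q : fischer P Q = fischer Q P.
Proof.
rewrite [in LHS](mpolyE Q) linear_sum; apply: eq_bigr => mu _.
by rewrite linearZ /= fischerX /GRing.scale /=; ring.
Qed.

Lemma mcoeff0_eval P : P@_0 = P.@[(0 : 'rV[K]_N) 0].
Proof.
rewrite [P]mpolyE !raddf_sum; apply: eq_bigr => mu _ /=.
rewrite mcoeffZ mcoeffX mevalZ mevalX; congr (_ * _); case: eqP => [->|/eqP mu0].
  by rewrite big1 // => i _; rewrite mnm0E expr0.
have [i mi] : exists i, mu i != 0%N.
  apply/existsP; apply: contraNT mu0; rewrite negb_exists => /forallP h.
  by apply/eqP/mnmP => i; rewrite mnm0E; have := h i; rewrite negbK => /eqP.
by rewrite (bigD1 i) //= mxE expr0n (negPf mi) mul0r.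
Qed.

Lemma fischer_mulX i P Q : fischer Q ('X_i * P) = fischer Q^`M(i) P.
Proof.
rewrite [P]mpolyE mulr_sumr !linear_sum; apply: eq_bigr => mu _.
have factE : (\prod_j ((mu + U_(i))%MM j)`! = \prod_j (mu j)`! * (mu i).+1)%N.
  rewrite (bigD1 i) //= [in RHS](bigD1 i) //= mnmDE mnm1E eqxx addn1 factS.
  rewrite (eq_bigr (fun j => (mu j)`!)) => [|j ne]; first by lia.
  by rewrite mnmDE mnm1E eq_sym (negPf ne) addn0.
rewrite -scalerAr !linearZ /= -mpolyXD !fischerX mcoeff_deriv.
by rewrite addmC factE natrM -[Q@_ _ *+ _]mulr_natl mulrA.
Qed.

(** Variables are stripped off [P] one at a time: [lsubst G] turns a variable into a linear form,
    whose adjoint is a combination of derivatives, and the chain rule [mderiv_lsubst] for the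
    transpose produces the same combination. *)
Lemma fischer_lsubst G P Q : fischer Q (lsubst G P) = fischer (lsubst G^T Q) P.
Proof.
pose good P := forall Q, fischer Q (lsubst G P) = fischer (lsubst G^T Q) P.
pose mgood R := forall P, good P -> good (R * P).
have good1 : good 1.
  move=> R; rewrite lsubst1 -mpolyX0 !fischerX; congr (_ * _).
  by rewrite !mcoeff0_eval lsubst_eval mul0mx.
have mgoodX i : mgood 'X_i.
  move=> R RP S; rewrite lsubstM lsubstX mulr_suml linear_sum fischer_mulX mderiv_lsubst.
  rewrite fischer_sym linear_sum; apply: eq_bigr => k _.
  by rewrite -scalerAl !linearZ /= fischer_mulX RP mxE [in RHS]fischer_sym.
have mgood1 : mgood 1 by move=> R; rewrite mul1r.
have mgoodM R S : mgood R -> mgood S -> mgood (R * S).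
  by move=> hR hS T hT; rewrite -mulrA; apply/hR/hS.
have goodX mu : good 'X_[mu].
  rewrite -['X_[mu]]mulr1; suff : mgood 'X_[mu] by apply.
  rewrite mpolyXE_id; apply: (big_ind mgood) => // i _.
  by elim: (mu i) => [|k IH]; rewrite ?expr0 // exprS; apply: mgoodM.
rewrite [P]mpolyE (linear_sum (lsubst G)) !raddf_sum /=; apply: eq_bigr => mu _.
by rewrite !linearZ /= goodX.
Qed.

(** The form is bilinear, not Hermitian; real coefficients make the value a sum of nonnegative
    terms. *)
Lemma fischer_neq0 P : P \is a mpolyOver N (@Num.Def.real_num_pred K) -> P != 0 -> fischer P P != 0.
Proof.
move=> /mpolyOverP Pr P0; rewrite /fischer.
have ge0 mu : 0 <= (P@_mu * (\prod_i (mu i)`!)%:R) * P@_mu.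
  by rewrite mulrAC -expr2 mulr_ge0 ?ler0n // real_exprn_even_ge0.
rewrite psumr_eq0 //; apply: contra P0 => /allP H; apply/eqP/mpolyP => mu.
rewrite mcoeff0; apply/eqP; have [h|] := boolP (mu \in msupp P); last first.
  by rewrite mcoeff_eq0.
have := H mu h; rewrite /= !mulf_eq0 pnatr_eq0 => /orP[/orP[//|]|//].
have : (0 < \prod_i (mu i)`!)%N by apply: prodn_gt0 => i; rewrite fact_gt0.
by case: (\prod_i _)%N.
Qed.

End LinearSubstitution.

(** * Polynomials in two vectors *)

Section PairEvaluation.
Variables (K : numFieldType) (m : nat).
Local Notation xv := (@lshift m m).
Local Notation yv := (@rshift m m).
Local Notation E := (polarize xv yv : {mpoly K[m + m]} -> {mpoly K[m + m]}).
Implicit Types (P Q : {mpoly K[m + m]}) (x y : 'rV[K]_m) (g h : 'M[K]_m).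

Definition pair_eval x y P := P.@[row_mx x y 0].

Lemma pair_eval_inj P Q : (forall x y, pair_eval x y P = pair_eval x y Q) -> P = Q.
Proof. by move=> H; apply: mpoly_row_inj => v; rewrite -[v]hsubmxK; apply: H. Qed.

Lemma pair_evalX x y mu : pair_eval x y 'X_[mu] =
  (\prod_i x 0 i ^+ mu (xv i)) * (\prod_i y 0 i ^+ mu (yv i)).
Proof.
rewrite /pair_eval mevalX big_split_ord /=; congr (_ * _); apply: eq_bigr => i _.
  by rewrite row_mxEl.
by rewrite row_mxEr.
Qed.

Lemma pair_evalE x y P : pair_eval x y P =
  \sum_(mu <- msupp P) P@_mu * pair_eval x y 'X_[mu].
Proof. by rewrite {1}/pair_eval mevalE; apply: eq_bigr => mu _; rewrite /pair_eval mevalX. Qed.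

Lemma bihom_eval_scale p q P a b x y : bihom xv yv p q P ->
  pair_eval (a *: x) (b *: y) P = a ^+ p * b ^+ q * pair_eval x y P.
Proof.
move=> [hx hy]; rewrite !(pair_evalE _ _ P) mulr_sumr !big_seq; apply: eq_bigr => mu hmu.
rewrite mulrCA; congr (_ * _); rewrite !pair_evalX -{1}(hx mu hmu) -(hy mu hmu) /vdeg.
rewrite -!prodrXr mulrACA; congr (_ * _); rewrite -big_split; apply: eq_bigr => i _ /=;
  by rewrite mxE exprMn.
Qed.

Lemma bihom_of_eval p q P :
  (forall a b x y, pair_eval (a *: x) (b *: y) P = a ^+ p * b ^+ q * pair_eval x y P) ->
  bihom xv yv p q P.
Proof.
move=> H; have two_inj k l : 2 ^+ k = 2 ^+ l :> K -> k = l.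
  by move/eqP; rewrite -!natrX eqr_nat eqn_exp2l // => /eqP.
have scale a b mu : P@_mu * (a ^+ vdeg xv mu * b ^+ vdeg yv mu) = a ^+ p * b ^+ q * P@_mu.
  pose d : 'rV[K]_(m + m) := row_mx (const_mx a) (const_mx b).
  have -> : a ^+ vdeg xv mu * b ^+ vdeg yv mu = \prod_i d 0 i ^+ mu i.
    rewrite big_split_ord /= /vdeg -!prodrXr; congr (_ * _); apply: eq_bigr => i _.
      by rewrite row_mxEl mxE.
    by rewrite row_mxEr mxE.
  rewrite -mcoeff_lsubst_diag -mcoeffZ; congr mcoeff.
  apply: pair_eval_inj => x y; rewrite /pair_eval lsubst_eval mevalZ -[RHS]H /pair_eval.
  apply: meval_eq => i; rewrite mul_mx_diag mxE -(splitK i); case: (split i) => j /=.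
    by rewrite !row_mxEl !mxE mulrC.
  by rewrite !row_mxEr !mxE mulrC.
(* Scaling one vector by 2 and fixing the other reads off one degree, the powers of 2 being
   distinct. *)
split=> mu; rewrite mcoeff_msupp => h; apply/two_inj/(mulfI h).
  by have := scale 2 1 mu; rewrite !expr1n !mulr1 => ->; rewrite mulrC.
by have := scale 1 2 mu; rewrite !expr1n !mul1r => ->; rewrite mulrC.
Qed.

Lemma poly_deriv0 (Q : {poly K}) : Q^`() = 0 -> forall s t, Q.[s] = Q.[t].
Proof.
move=> Q0; have /size1_polyC -> : (size Q <= 1)%N.
  apply/leq_sizeP => -[//|i] _; have := congr1 (fun q : {poly K} => q`_i) Q0.
  by rewrite coef_deriv coef0 => /eqP; rewrite mulrn_eq0 => /eqP.
by move=> s t; rewrite !hornerC.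
Qed.

(** The derivative in c of P(x, y + c x) is (E P)(x, y + c x). *)
Lemma raise_eq0P P : E P = 0 <->
  forall c x y, pair_eval x (y + c *: x) P = pair_eval x y P.
Proof.
pose h x y i := match split i with inl j => (x 0 j)%:P | inr j => (y 0 j)%:P + x 0 j *: 'X end
  : {poly K}.
have hE x y c : (mmap polyC (h x y) P).[c] = pair_eval x (y + c *: x) P.
  rewrite horner_mmap; apply: meval_eq => i; rewrite /h -(splitK i) unsplitK.
  case: (split i) => j /=; first by rewrite hornerC row_mxEl.
  by rewrite hornerD hornerZ hornerC hornerX row_mxEr !mxE mulrC.
have dE x y c : ((mmap polyC (h x y) P)^`()).[c] = pair_eval x (y + c *: x) (E P).
  rewrite deriv_mmap big_split_ord /= big1 ?add0r => [|i _]; last first.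
    by rewrite /h -[lshift m i]/(unsplit (inl i)) unsplitK derivC mulr0.
  rewrite horner_sum /pair_eval /polarize raddf_sum; apply: eq_bigr => j _ /=.
  rewrite mevalM mevalXU row_mxEl hornerM mulrC; congr (_ * _).
    rewrite /h -[rshift m j]/(unsplit (inr j)) unsplitK derivD derivC derivZ derivX add0r.
    by rewrite hornerZ hornerC mulr1.
  rewrite horner_mmap; apply: meval_eq => i; rewrite /h -(splitK i) unsplitK.
  case: (split i) => k /=; first by rewrite hornerC row_mxEl.
  by rewrite hornerD hornerZ hornerC hornerX row_mxEr !mxE mulrC.
split=> [EP c x y|H].
  rewrite -hE -[in RHS](addr0 y) -[in RHS](scale0r x) -hE; apply: poly_deriv0.
  by apply: poly_fun_eq0 => t; rewrite dE EP /pair_eval meval0.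
apply: pair_eval_inj => x y; rewrite -[in LHS](addr0 y) -[in LHS](scale0r x) -dE.
rewrite (_ : mmap _ _ _ = (pair_eval x y P)%:P) ?derivC ?horner0 /pair_eval ?meval0 //.
apply/eqP; rewrite -subr_eq0; apply/eqP/poly_fun_eq0 => t.
by rewrite hornerD hornerN hornerC hE H subrr.
Qed.

Definition pair_subst g P := lsubst (block_mx g 0 0 g) P.

Fact pair_subst_linear g : linear (pair_subst g).
Proof. by move=> c p q; rewrite /pair_subst linearP. Qed.

HB.instance Definition _ g := GRing.isLinear.Build K {mpoly K[m + m]} {mpoly K[m + m]} _
  (pair_subst g) (pair_subst_linear g).

Lemma pair_subst_eval g x y P : pair_eval x y (pair_subst g P) = pair_eval (x *m g) (y *m g) P.
Proof. by rewrite /pair_eval lsubst_eval mul_row_block !mulmx0 addr0 add0r. Qed.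

Lemma pair_subst_mul g h P : pair_subst g (pair_subst h P) = pair_subst (g *m h) P.
Proof. by apply: pair_eval_inj => x y; rewrite !pair_subst_eval !mulmxA. Qed.

Lemma pair_subst1 P : pair_subst 1%:M P = P.
Proof. by apply: pair_eval_inj => x y; rewrite pair_subst_eval !mulmx1. Qed.

Lemma bihom_pair_subst g p q P : bihom xv yv p q P -> bihom xv yv p q (pair_subst g P).
Proof.
move=> hP; apply: bihom_of_eval => a b x y.
by rewrite !pair_subst_eval -!scalemxAl (bihom_eval_scale _ _ _ _ hP).
Qed.

Lemma raise_pair_subst g P : E P = 0 -> E (pair_subst g P) = 0.
Proof.
move=> /raise_eq0P hP; apply/raise_eq0P => c x y.
by rewrite !pair_subst_eval mulmxDl -scalemxAl hP.
Qed.

Lemma pair_subst_scale c g p q P : bihom xv yv p q P ->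
  pair_subst (c *: g) P = c ^+ (p + q) *: pair_subst g P.
Proof.
move=> hP; apply: pair_eval_inj => x y; rewrite pair_subst_eval -!scalemxAr.
rewrite (bihom_eval_scale _ _ _ _ hP) {2}/pair_eval mevalZ -exprD.
by rewrite -/(pair_eval x y _) pair_subst_eval.
Qed.

Definition torus_weight (mu : 'X_{1..m + m}) := (\sum_(i < m) i * (mu (xv i) + mu (yv i)))%N.

Lemma pair_subst_torus s P :
  pair_subst (diag_mx (\row_(i < m) s ^+ i)) P =
  \sum_(mu <- msupp P) (P@_mu * s ^+ torus_weight mu) *: 'X_[mu].
Proof.
pose d : 'rV[K]_m := \row_(i < m) s ^+ i.
rewrite /pair_subst -/d (_ : block_mx _ _ _ _ = diag_mx (row_mx d d)); last by rewrite diag_mx_row.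
rewrite lsubst_diag; apply: eq_bigr => mu _; congr (_ * _ *: _).
rewrite big_split_ord /= -big_split -prodrXr; apply: eq_bigr => i _ /=.
by rewrite row_mxEl row_mxEr mxE -!exprM -exprD mulnDr.
Qed.

Lemma fischer_pair_subst g P Q : fischer Q (pair_subst g P) = fischer (pair_subst g^T Q) P.
Proof. by rewrite /pair_subst fischer_lsubst tr_block_mx !trmx0. Qed.

End PairEvaluation.

(** * The two-row representation *)

Section PolynomialFamilies.
Variables (R : realType) (m : nat).
Local Notation C := R[i].

(** Closure under sums and products, proved next, yields the regularity of the matrix coefficients
    of the model. *)
Definition mx_poly_fun (f : 'M[C]_m -> C) : Prop :=
  exists P : {mpoly C[m * m]}, forall A, f A = P.@[fun k => mxvec A 0 k].

Lemma mx_poly_fun_cst c : mx_poly_fun (fun=> c).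
Proof. by exists c%:MP => A; rewrite mevalC. Qed.

Lemma mx_poly_funD f g : mx_poly_fun f -> mx_poly_fun g -> mx_poly_fun (fun A => f A + g A).
Proof. by move=> [P HP] [Q HQ]; exists (P + Q) => A; rewrite mevalD HP HQ. Qed.

Lemma mx_poly_funM f g : mx_poly_fun f -> mx_poly_fun g -> mx_poly_fun (fun A => f A * g A).
Proof. by move=> [P HP] [Q HQ]; exists (P * Q) => A; rewrite mevalM HP HQ. Qed.

Lemma mx_poly_fun_entry i j : mx_poly_fun (fun A => A i j).
Proof. by exists 'X_(mxvec_index i j) => A; rewrite mevalXU mxvecE. Qed.

Lemma mx_poly_fun_ext f g : f =1 g -> mx_poly_fun f -> mx_poly_fun g.
Proof. by move=> fg [P HP]; exists P => A; rewrite -fg HP. Qed.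

Lemma mx_poly_fun_sum (I : Type) (r : seq I) (p : pred I) (f : I -> 'M[C]_m -> C) :
  (forall i, mx_poly_fun (f i)) -> mx_poly_fun (fun A => \sum_(i <- r | p i) f i A).
Proof.
move=> H; elim: r => [|i r IH].
  by apply: (mx_poly_fun_ext _ (mx_poly_fun_cst 0)) => A; rewrite big_nil.
have [pi|pi] := boolP (p i).
  by apply: (mx_poly_fun_ext _ (mx_poly_funD (H i) IH)) => A; rewrite big_cons pi.
by apply: (mx_poly_fun_ext _ IH) => A; rewrite big_cons (negPf pi).
Qed.

Variable N : nat.

Definition mpoly_family (Q : 'M[C]_m -> {mpoly C[N]}) : Prop :=
  forall mu, mx_poly_fun (fun A => (Q A)@_mu).

Lemma mpoly_familyM Q S : mpoly_family Q -> mpoly_family S -> mpoly_family (fun A => Q A * S A).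
Proof.
move=> hQ hS mu; apply: (mx_poly_fun_ext (fun A => esym (mcoeffM (Q A) (S A) mu))).
by apply: mx_poly_fun_sum => k; apply: mx_poly_funM.
Qed.

Lemma mpoly_family1 : mpoly_family (fun=> 1).
Proof. by move=> mu; apply: mx_poly_fun_cst. Qed.

Lemma mpoly_familyX Q k : mpoly_family Q -> mpoly_family (fun A => Q A ^+ k).
Proof.
move=> hQ; elim: k => [|k IH]; first exact: mpoly_family1.
by move=> mu; apply: (mx_poly_fun_ext _ (mpoly_familyM hQ IH mu)) => A; rewrite exprS.
Qed.

Lemma mpoly_family_prod (I : Type) (r : seq I) (Q : I -> 'M[C]_m -> {mpoly C[N]}) :
  (forall i, mpoly_family (Q i)) -> mpoly_family (fun A => \prod_(i <- r) Q i A).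
Proof.
move=> H; elim: r => [|i r IH] mu.
  by apply: (mx_poly_fun_ext _ (mpoly_family1 mu)) => A; rewrite big_nil.
by apply: (mx_poly_fun_ext _ (mpoly_familyM (H i) IH mu)) => A; rewrite big_cons.
Qed.

End PolynomialFamilies.

Lemma mpoly_family_pair_subst (R : realType) m (P : {mpoly R[i][m + m]}) :
  mpoly_family (fun A : 'M[R[i]]_m => pair_subst A P).
Proof.
have forms i : mpoly_family (fun A : 'M[R[i]]_m => tnth (linear_forms (block_mx A 0 0 A)) i).
  move=> mu; pose f k (A : 'M[R[i]]_m) := block_mx A 0 0 A k i * ('X_k : {mpoly R[i][m + m]})@_mu.
  apply: (@mx_poly_fun_ext _ _ (fun A => \sum_k f k A)).
    move=> A; rewrite tnth_mktuple raddf_sum; apply: eq_bigr => k _ /=.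
    by rewrite mcoeffZ.
  apply: mx_poly_fun_sum => k; apply: mx_poly_funM; last exact: mx_poly_fun_cst.
  rewrite -(splitK k) -(splitK i); case: (split k) => a; case: (split i) => b /=.
  - apply: (mx_poly_fun_ext _ (mx_poly_fun_entry R a b)) => A.
    by rewrite block_mxEul.
  - by apply: (mx_poly_fun_ext _ (mx_poly_fun_cst m 0)) => A; rewrite block_mxEur mxE.
  - by apply: (mx_poly_fun_ext _ (mx_poly_fun_cst m 0)) => A; rewrite block_mxEdl mxE.
  - apply: (mx_poly_fun_ext _ (mx_poly_fun_entry R a b)) => A.
    by rewrite block_mxEdr.
move=> mu.
pose Q nu (A : 'M[R[i]]_m) := \prod_i tnth (linear_forms (block_mx A 0 0 A)) i ^+ nu i.
apply: (@mx_poly_fun_ext _ _ (fun A => \sum_(nu <- msupp P) P@_nu * (Q nu A)@_mu)).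
  move=> A; rewrite /pair_subst /lsubst comp_mpolyEX raddf_sum; apply: eq_bigr => nu _ /=.
  by rewrite mcoeffZ comp_mpolyX.
apply: mx_poly_fun_sum => nu; apply: mx_poly_funM; first exact: mx_poly_fun_cst.
by apply: mpoly_family_prod => i; apply: mpoly_familyX.
Qed.

Lemma det_mx2 (A : comNzRingType) (M : 'M[A]_2) : \det M = M 0 0 * M 1 1 - M 0 1 * M 1 0.
Proof.
rewrite (expand_det_row M 0) !big_ord_recl big_ord0 addr0 /cofactor !det_mx11 !mxE /=.
rewrite expr0 mul1r expr1 mulN1r mulrN; congr (_ * M _ _ - M _ _ * M _ _); exact: val_inj.
Qed.

(** * The model representation and its irreducibility *)

Section Model.
Variables (R : realType) (k p q : nat).
Hypothesis qp : (q <= p)%N.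
Local Notation C := R[i].
Local Notation m := k.+2.
Local Notation xv := (@lshift m m).
Local Notation yv := (@rshift m m).
Local Notation E := (polarize xv yv : {mpoly C[m + m]} -> {mpoly C[m + m]}).
Local Notation SL := (@SL R m).
Local Notation U := (model_space C m p q).
Local Notation V := (subvs_of U).
Local Notation i0 := (ord0 : 'I_m).
Local Notation i1 := (lift ord0 ord0 : 'I_m).
Local Notation co := (@coords_of_mpoly C (m + m) (bimonomials m p q)).
Implicit Types (w : V) (g : 'M[C]_m) (x y : 'rV[C]_m).

Definition pol w : {mpoly C[m + m]} := mpoly_of_coords (vsval w).

Fact pol_linear : linear pol.
Proof. by move=> c u w; rewrite /pol linearP. Qed.

HB.instance Definition _ := GRing.isLinear.Build C V {mpoly C[m + m]} _ pol pol_linear.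

Lemma pol_inj : injective pol.
Proof.
move=> u w /(congr1 co).
by rewrite !mpoly_of_coordsK ?bimonomials_uniq // => /subvs_inj.
Qed.

Lemma pol_bihom w : bihom xv yv p q (pol w).
Proof. exact: bihom_mpoly_of_coords. Qed.

Lemma pol_raise w : E (pol w) = 0.
Proof. by apply/eqP; rewrite -mem_model_space subvsP. Qed.

Lemma pol_vsproj P : bihom xv yv p q P -> E P = 0 ->
  pol (vsproj U (co P)) = P.
Proof.
move=> hP EP; have cK : mpoly_of_coords (co P) = P.
  by rewrite coords_of_mpolyK ?bimonomials_uniq //; apply/bihom_subset.
by rewrite /pol vsprojK ?cK // mem_model_space cK EP.
Qed.

Definition model_rep g : 'End(V) :=
  linfun (vsproj U \o (co \o (pair_subst g \o pol))).

Lemma pol_rep g w : pol (model_rep g w) = pair_subst g (pol w).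
Proof.
rewrite lfunE /= pol_vsproj //; first exact/bihom_pair_subst/pol_bihom.
exact/raise_pair_subst/pol_raise.
Qed.

Lemma model_is_rep : is_rep model_rep.
Proof.
split.
- by apply/lfunP => w; apply: pol_inj; rewrite pol_rep pair_subst1 id_lfunE.
- move=> A B _ _; apply/lfunP => w; apply: pol_inj.
  by rewrite comp_lfunE !pol_rep pair_subst_mul.
move=> phi w; pose s := bimonomials m p q.
(* The vector is expanded in the standard basis of the coordinate space. Basis vectors may lie
   outside [U], so [vsproj U] is distributed over the sum by linearity. *)
pose f (i : 'I_(size s)) (A : 'M[C]_m) :=
  (pair_subst A (pol w))@_(nth 0%MM s i) * (phi (vsproj U (delta_mx 0 i)) : C).
suff [P PE] : mx_poly_fun (fun A => phi (model_rep A w)) by exists P => A _.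
apply: (@mx_poly_fun_ext _ _ (fun A => \sum_i f i A)).
  move=> A; rewrite lfunE /= [coords_of_mpoly _ _]row_sum_delta 2!linear_sum.
  by apply: eq_bigr => i _; rewrite mxE !linearZ.
apply: mx_poly_fun_sum => i; apply: mx_poly_funM; last exact: mx_poly_fun_cst.
exact: mpoly_family_pair_subst.
Qed.

Definition hw_poly : {mpoly C[m + m]} :=
  'X_(xv i0) ^+ (p - q) * ('X_(xv i0) * 'X_(yv i1) - 'X_(xv i1) * 'X_(yv i0)) ^+ q.

Definition minor2 x y := x 0 i0 * y 0 i1 - x 0 i1 * y 0 i0.

Lemma hw_eval x y : pair_eval x y hw_poly = x 0 i0 ^+ (p - q) * minor2 x y ^+ q.
Proof.
rewrite /pair_eval mevalM !rmorphXn /= mevalB !mevalM !mevalXU.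
by rewrite !row_mxEl !row_mxEr.
Qed.

Lemma hw_bihom : bihom xv yv p q hw_poly.
Proof.
apply: bihom_of_eval => a b x y; rewrite !hw_eval.
have -> : a ^+ p = a ^+ (p - q) * a ^+ q by rewrite -exprD subnK.
have -> : minor2 (a *: x) (b *: y) = (a * b) * minor2 x y.
  by rewrite /minor2 !mxE; ring.
by rewrite mxE !exprMn; ring.
Qed.

Lemma hw_raise : E hw_poly = 0.
Proof.
apply/raise_eq0P => c x y; rewrite !hw_eval; congr (_ * _ ^+ _).
by rewrite /minor2 !mxE; ring.
Qed.

Definition hw_vec : V := vsproj U (co hw_poly).

Lemma pol_hw : pol hw_vec = hw_poly.
Proof. exact: pol_vsproj hw_bihom hw_raise. Qed.

Let e0 : 'rV[C]_m := delta_mx 0 i0.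
Let e1 : 'rV[C]_m := delta_mx 0 i1.

Lemma minor2_e01 : minor2 e0 e1 = 1.
Proof. by rewrite /minor2 !mxE /= mulr0 subr0 mulr1. Qed.

Lemma hw_poly_neq0 : hw_poly != 0.
Proof.
apply/eqP => h; have := hw_eval e0 e1; rewrite h minor2_e01 expr1n mulr1 /pair_eval meval0.
by rewrite mxE /= expr1n => /esym/eqP; rewrite oner_eq0.
Qed.

Lemma hw_vec_neq0 : hw_vec != 0.
Proof. by apply: contraNneq hw_poly_neq0 => h; rewrite -pol_hw h linear0. Qed.

Lemma hw_poly_real : hw_poly \is a mpolyOver (m + m) (@Num.Def.real_num_pred _).
Proof. by rewrite /hw_poly rpredM ?rpredX ?rpredB ?rpredM ?mpolyOverX. Qed.

Lemma model_highest_weight (lam : 'rV[int]_m) :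
  lam 0 i0 = p%:Z -> lam 0 i1 = q%:Z -> (forall i : 'I_m, (1 < i)%N -> lam 0 i = 0) ->
  has_highest_weight lam model_rep.
Proof.
move=> lam0 lam1 lam2; exists hw_vec; first exact: hw_vec_neq0.
move=> B _ /is_trig_mxP Btrig; apply: pol_inj; rewrite pol_rep linearZ /= pol_hw.
have -> : borel_char lam B = B i0 i0 ^+ p * B i1 i1 ^+ q.
  rewrite /borel_char 2!big_ord_recl big1 => [|i _]; last by rewrite lam2.
  by rewrite lam0 lam1 -!exprnP mulr1.
apply: pair_eval_inj => x y; rewrite pair_subst_eval {2}/pair_eval mevalZ -/(pair_eval x y _).
have col0 (z : 'rV[C]_m) : (z *m B) 0 i0 = z 0 i0 * B i0 i0.
  rewrite mxE big_ord_recl big1 ?addr0 // => i _.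
  by have := Btrig ord0 (lift ord0 i) isT; rewrite mxE => ->; rewrite mulr0.
have col1 (z : 'rV[C]_m) : (z *m B) 0 i1 = z 0 i0 * B i0 i1 + z 0 i1 * B i1 i1.
  rewrite mxE 2!big_ord_recl big1 ?addr0 // => i _.
  by have := Btrig i1 (lift ord0 (lift ord0 i)) isT; rewrite mxE => ->; rewrite mulr0.
rewrite !hw_eval col0.
have -> : B i0 i0 ^+ p = B i0 i0 ^+ (p - q) * B i0 i0 ^+ q by rewrite -exprD subnK.
have -> : minor2 (x *m B) (y *m B) = minor2 x y * (B i0 i0 * B i1 i1).
  by rewrite /minor2 !col0 !col1; ring.
by rewrite !exprMn; ring.
Qed.
Lemma invariant_rep (W : {vspace V}) g w :
  (forall A, A \in SL -> (model_rep A @: W <= W)%VS) -> g \in SL -> w \in W ->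
  model_rep g w \in W.
Proof. by move=> Winv gSL wW; apply: (subvP (Winv g gSL)); apply: memv_img. Qed.

(** A nonzero [F0] and the minor [D] are simultaneously nonzero at some (x, y), since their product
    is a nonzero polynomial; an element of SL carries (e0, e1) there up to scaling. *)
Lemma exists_nonzero_at_e01 (W : {vspace V}) :
  (forall A, A \in SL -> (model_rep A @: W <= W)%VS) -> W != 0%VS ->
  exists2 w, w \in W & pair_eval e0 e1 (pol w) != 0.
Proof.
move=> Winv W0; set w0 := vpick W; set F0 := pol w0.
have F00 : F0 != 0.
  by apply: contraNneq W0 => h; rewrite -vpick0 -/w0; apply/eqP/pol_inj; rewrite linear0.
pose D : {mpoly C[m + m]} := 'X_(xv i0) * 'X_(yv i1) - 'X_(xv i1) * 'X_(yv i0).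
have DE x y : pair_eval x y D = minor2 x y.
  by rewrite /pair_eval mevalB !mevalM !mevalXU !row_mxEl !row_mxEr.
have D0 : D != 0.
  apply/eqP => h; have := DE e0 e1; rewrite h minor2_e01 /pair_eval meval0 => /esym/eqP.
  by rewrite oner_eq0.
have [x [y [F1 d1]]] : exists x y, pair_eval x y F0 != 0 /\ minor2 x y != 0.
  apply: boolp.contrapT => H; suff /eqP : F0 * D = 0.
    by rewrite mulf_eq0 (negPf F00) (negPf D0).
  apply: pair_eval_inj => x y; rewrite /pair_eval mevalM meval0 -!/(pair_eval x y _) DE.
  have [->|Fxy] := eqVneq (pair_eval x y F0) 0; first by rewrite mul0r.
  have [->|dxy] := eqVneq (minor2 x y) 0; first by rewrite mulr0.
  by case: H; exists x, y.
set d := minor2 x y in d1.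
(* Dividing [x] by [d] makes the leading minor, hence [\det g], equal to 1; bihomogeneity absorbs
   this scaling. *)
pose A : 'M[C]_(2, 2 + k) := \matrix_(i, j) (if i == 0 then d^-1 * x 0 j else y 0 j).
pose g : 'M[C]_m := block_mx (lsubmx A) (rsubmx A) 0 1%:M.
have rowg0 : row i0 g = d^-1 *: x.
  apply/rowP => j; rewrite [LHS]mxE [RHS]mxE /g.
  have -> : i0 = lshift k (0 : 'I_2) by apply: val_inj.
  rewrite -(@splitK 2 k j); case: (@split 2 k j) => l /=.
    by rewrite (@block_mxEul _ 2 k 2 k) !mxE.
  by rewrite (@block_mxEur _ 2 k 2 k) !mxE.
have rowg1 : row i1 g = y.
  apply/rowP => j; rewrite mxE /g.
  have -> : i1 = lshift k (1 : 'I_2) by apply: val_inj.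
  rewrite -(@splitK 2 k j); case: (@split 2 k j) => l /=.
    by rewrite (@block_mxEul _ 2 k 2 k) !mxE.
  by rewrite (@block_mxEur _ 2 k 2 k) !mxE.
have gSL : g \in SL.
  rewrite inE; have -> : \det g = \det (lsubmx A) * \det (1%:M : 'M[C]_k).
    exact: (@det_ublock _ 2 k).
  rewrite det1 mulr1 det_mx2 !mxE /=.
  have -> : lshift k (0 : 'I_2) = i0 by apply: val_inj.
  have -> : lshift k (1 : 'I_2) = i1 by apply: val_inj.
  apply/eqP; transitivity (d^-1 * d); last exact: mulVf.
  by move: (d^-1) => e; rewrite /d /minor2; ring.
exists (model_rep g w0); first exact: invariant_rep (memv_pick W).
rewrite pol_rep pair_subst_eval -!rowE rowg0 rowg1 -[y]scale1r.
by rewrite (bihom_eval_scale _ _ _ _ (pol_bihom w0)) expr1n mulr1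
   mulf_neq0 // expf_neq0 // invr_eq0.
Qed.

Definition weight_part n (F : {mpoly C[m + m]}) :=
  \sum_(mu <- [seq mu <- msupp F | torus_weight mu == n]) F@_mu *: 'X_[mu].

Lemma weight_part_coef (f : 'X_{1..m + m} -> C) n (F : {mpoly C[m + m]}) :
  (\sum_(mu <- msupp F) (F@_mu * f mu) *: 'X^(torus_weight mu))`_n =
  \sum_(mu <- [seq mu <- msupp F | torus_weight mu == n]) F@_mu * f mu.
Proof.
rewrite coef_sum big_filter [RHS]big_mkcond; apply: eq_bigr => mu _.
by rewrite coefZ coefXn eq_sym; case: eqP; rewrite ?mulr1 ?mulr0.
Qed.

Lemma weight_part_torus n s F :
  pair_subst (diag_mx (\row_(i < m) s ^+ i)) (weight_part n F) = s ^+ n *: weight_part n F.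
Proof.
rewrite linear_sum scaler_sumr !big_filter; apply: eq_bigr => mu /eqP hmu.
rewrite linearZ /= pair_subst_torus msuppX big_seq1 mcoeffX eqxx mul1r hmu.
by rewrite !scalerA mulrC.
Qed.

Lemma weight_part_bihom n F : bihom xv yv p q F -> bihom xv yv p q (weight_part n F).
Proof.
move=> [hx hy]; split; apply: vhomog_sum => mu; rewrite mem_filter => /andP[_ hmu].
  by rewrite -(hx mu hmu); apply/vhomogZ/vhomogX.
by rewrite -(hy mu hmu); apply/vhomogZ/vhomogX.
Qed.

(** The torus fixes [e0] and multiplies [e1] by s, so F is multiplied by s^q at this pair; the
    coefficients of s^q are compared. *)
Lemma weight_part_eval F : bihom xv yv p q F ->
  pair_eval e0 e1 (weight_part q F) = pair_eval e0 e1 F.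
Proof.
move=> hF; pose Q := \sum_(mu <- msupp F)
  (F@_mu * pair_eval e0 e1 'X_[mu]) *: 'X^(torus_weight mu) - pair_eval e0 e1 F *: 'X^q.
have Q0 : Q = 0.
  apply: poly_fun_eq0 => s; rewrite hornerD hornerN hornerZ hornerXn horner_sum.
  apply/eqP; rewrite subr_eq0; apply/eqP.
  transitivity (pair_eval e0 e1 (pair_subst (diag_mx (\row_(i < m) s ^+ i)) F)).
    rewrite pair_subst_torus {2}/pair_eval raddf_sum; apply: eq_bigr => mu _ /=.
    by rewrite hornerZ hornerXn mevalZ -/(pair_eval _ _ _) mulrAC.
  rewrite pair_subst_eval.
  have -> : e0 *m diag_mx (\row_(i < m) s ^+ i) = 1 *: e0.
    rewrite mul_mx_diag scale1r; apply/rowP => j; rewrite !mxE.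
    by have [->|_] := eqVneq j i0; rewrite ?mulr1 ?mul0r.
  have -> : e1 *m diag_mx (\row_(i < m) s ^+ i) = s *: e1.
    rewrite mul_mx_diag; apply/rowP => j; rewrite !mxE.
    by have [->|_] := eqVneq j i1; rewrite ?mulr0 ?mul0r // mul1r mulr1.
  by rewrite (bihom_eval_scale _ _ _ _ hF) expr1n mul1r mulrC.
have := congr1 (fun r : {poly C} => r`_q) Q0.
rewrite coefB coefZ coefXn eqxx mulr1 weight_part_coef coef0 => /eqP.
rewrite subr_eq0 => /eqP <-; rewrite /weight_part {1}/pair_eval raddf_sum.
by apply: eq_bigr => mu _ /=; rewrite mevalZ.
Qed.

(* A functional vanishing on W, applied to the torus orbit of w, is a polynomial in the
   torus parameter that vanishes identically, so it kills each weight component of w. *)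
Lemma invariant_weight_part (W : {vspace V}) w n :
  (forall A, A \in SL -> (model_rep A @: W <= W)%VS) -> w \in W ->
  exists2 w', w' \in W & pol w' = weight_part n (pol w).
Proof.
move=> Winv wW; set F := pol w; have hF : bihom xv yv p q F := pol_bihom w.
(* The weight part is not yet known to be killed by [E], so membership is tested in the ambient
   coordinate space. *)
pose W' := (linfun (vsval : V -> 'rV[C]_(size (bimonomials m p q))) @: W)%VS.
suff /memv_imgP[w' w'W E'] : co (weight_part n F) \in W'.
  exists w' => //; rewrite /pol; rewrite lfunE /= in E'; rewrite -E'.
  by rewrite coords_of_mpolyK ?bimonomials_uniq //; apply/bihom_subset/weight_part_bihom.
apply/negPn/negP => /separating_functional[psi [psi1 psiW]].
pose Q := \sum_(mu <- msupp F) (F@_mu * (psi (co 'X_[mu]) : C)) *: 'X^(torus_weight mu).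
have Q0 : Q = 0.
  apply: poly_fun_eq0_unit => s s0; rewrite horner_sum.
  have [c c0 TSL] := scaled_torus_SL m.-1 s0.
  (* The scalar [c] puts the torus element in SL; its effect [c ^+ (p + q)] on bidegree (p, q) is
     undone. *)
  pose u := (c ^+ (p + q))^-1 *: model_rep (c *: diag_mx (\row_(i < m) s ^+ i)) w.
  have uW : u \in W by apply/memvZ/invariant_rep.
  have polu : pol u = pair_subst (diag_mx (\row_(i < m) s ^+ i)) F.
    rewrite linearZ /= pol_rep (pair_subst_scale _ _ hF) scalerA mulVf ?scale1r //.
    by rewrite expf_neq0.
  have cu : vsval u = co (pol u) by rewrite /pol mpoly_of_coordsK ?bimonomials_uniq.
  have psiu : psi (vsval u) = 0.
    by apply: psiW; rewrite -[vsval u](lfunE (vsval : V -> _)); apply: memv_img.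
  rewrite -[RHS]psiu cu polu pair_subst_torus 2!linear_sum; apply: eq_bigr => mu _ /=.
  by rewrite 2!linearZ /= hornerZ hornerXn /GRing.scale /=; ring.
have := congr1 (fun r : {poly C} => r`_n) Q0; rewrite weight_part_coef coef0.
have -> : \sum_(mu <- [seq mu <- msupp F | torus_weight mu == n]) F@_mu * (psi (co 'X_[mu]) : C)
   = psi (co (weight_part n F)).
  by rewrite 2!linear_sum; apply: eq_bigr => mu _; rewrite 2!linearZ.
by rewrite psi1 => /eqP; rewrite oner_eq0.
Qed.

(* Acting by the torus and letting the parameter tend to 0 reduces the value at (x, y),
   normalized by y_0 = 0, to the value at multiples of (e0, e1). *)
Lemma highest_weight_unique G : bihom xv yv p q G -> E G = 0 ->
  (forall s, pair_subst (diag_mx (\row_(i < m) s ^+ i)) G = s ^+ q *: G) ->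
  G = pair_eval e0 e1 G *: hw_poly.
Proof.
move=> hG EG Gs; set c := pair_eval e0 e1 G.
have evG x y : x 0 i0 != 0 -> pair_eval x y G = c * pair_eval x y hw_poly.
  (* Adding a multiple of [x] to [y] changes neither [G] nor the minor, and makes the first
     coordinate vanish. *)
  move=> x0; rewrite hw_eval; pose a := - (y 0 i0 / x 0 i0); pose z := y + a *: x.
  have z0 : z 0 i0 = 0 by rewrite !mxE /a mulNr mulfVK ?subrr.
  have z1 : z 0 i1 = minor2 x y / x 0 i0.
    by rewrite !mxE /a /minor2; field.
  have evz : pair_eval x z G = pair_eval x y G by have /raise_eq0P := EG; apply.
  clearbody z.
  (* The torus acts on both vectors and the second is divided by s, which cancels the weight s^q.
     The result is polynomial in s because [z] has zero first coordinate, so the truncation of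
     [j.-1] at 0 is harmless. *)
  pose h i : {poly C} := match split i with
    | inl j => x 0 j *: 'X^j | inr j => z 0 j *: 'X^(j.-1) end.
  have Q0 : mmap polyC h G - (pair_eval x z G)%:P = 0.
    apply: poly_fun_eq0_unit => s s0; rewrite hornerD hornerN hornerC horner_mmap.
    pose D := diag_mx (\row_(i < m) s ^+ i).
    have -> : G.@[fun i => (h i).[s]] = pair_eval (1 *: (x *m D)) (s^-1 *: (z *m D)) G.
      apply: meval_eq => i; rewrite /h -(splitK i) unsplitK; case: (split i) => j /=.
        by rewrite row_mxEl hornerZ hornerXn scale1r mul_mx_diag !mxE.
      rewrite row_mxEr hornerZ hornerXn mul_mx_diag !mxE.
      have [j0|j0] := posnP j.
        by have -> : j = i0; [exact: val_inj | rewrite z0 !mul0r mulr0].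
      by rewrite -{2}(prednK j0) exprS mulrCA mulKf.
    rewrite (bihom_eval_scale _ _ _ _ hG) expr1n mul1r -pair_subst_eval Gs.
    rewrite {1}/pair_eval mevalZ mulrA -exprMn mulVf // expr1n mul1r.
    by rewrite subrr.
  have := congr1 (horner^~ 0) Q0; rewrite hornerD hornerN hornerC horner0 horner_mmap evz => /eqP.
  rewrite subr_eq0 => /eqP <-.
  (* At s = 0 only the first coordinate of [x] and the second of [z] survive. *)
  have -> : G.@[fun i => (h i).[0]] = pair_eval (x 0 i0 *: e0) (z 0 i1 *: e1) G.
    apply: meval_eq => i; rewrite /h -(splitK i) unsplitK; case: (split i) => j /=.
      rewrite row_mxEl hornerZ hornerXn expr0n !mxE /=.
      by have [->|j0] := eqVneq j i0; rewrite //= [_ == 0%N](negPf j0) !mulr0.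
    rewrite row_mxEr hornerZ hornerXn expr0n !mxE /=.
    have [->|ne1] := eqVneq j i1; first by [].
    rewrite mulr0.
    have [->|ne0] := eqVneq j i0; first by rewrite z0 mul0r.
    have j2 : (1 < j)%N.
      move: ne0 ne1; rewrite -!val_eqE /= /bump /=.
      by case: (nat_of_ord j) => [|[|]].
    by case: (nat_of_ord j) j2 => [|[|n]] //= _; rewrite mulr0.
  rewrite (bihom_eval_scale _ _ _ _ hG) -/c z1 expr_div_n mulrC; congr (_ * _).
  have -> : x 0 i0 ^+ p = x 0 i0 ^+ (p - q) * x 0 i0 ^+ q by rewrite -exprD subnK.
  by rewrite mulrA mulrAC mulfK // expf_neq0.
(* Multiplication by the first coordinate of x removes the restriction that it be nonzero. *)
apply/eqP; rewrite -subr_eq0; have : (G - c *: hw_poly) * 'X_(xv i0) == 0.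
  apply/eqP/pair_eval_inj => x y; rewrite /pair_eval mevalM mevalB mevalZ meval0 mevalXU row_mxEl.
  have [->|x0] := eqVneq (x 0 i0) 0; first by rewrite mulr0.
  by rewrite -!/(pair_eval x y _) evG // subrr mul0r.
rewrite mulf_eq0 => /orP[//|/eqP h]; have := congr1 (meval (row_mx e0 e1 0)) h.
rewrite mevalXU row_mxEl mxE meval0 /= => /eqP; by rewrite oner_eq0.
Qed.

Lemma invariant_contains_hw (W : {vspace V}) :
  (forall A, A \in SL -> (model_rep A @: W <= W)%VS) -> W != 0%VS -> hw_vec \in W.
Proof.
move=> Winv /(exists_nonzero_at_e01 Winv)[w wW w01].
have [w' w'W polw'] := invariant_weight_part q Winv wW.
have e01 : pair_eval e0 e1 (pol w') = pair_eval e0 e1 (pol w).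
  by rewrite polw' weight_part_eval //; apply: pol_bihom.
have polE : pol w' = pair_eval e0 e1 (pol w) *: pol hw_vec.
  rewrite pol_hw -e01; apply: highest_weight_unique => [||s].
  - exact: pol_bihom.
  - exact: pol_raise.
  - by rewrite polw' weight_part_torus.
have -> : hw_vec = (pair_eval e0 e1 (pol w))^-1 *: w'.
  by apply: pol_inj; rewrite linearZ /= polE scalerA mulVf ?scale1r.
exact: memvZ.
Qed.

(* The orthogonal of the orbit of hw_vec for Fischer's form is invariant and does not
   contain hw_vec, hence is zero. *)
Lemma hw_orbit_generates (W : {vspace V}) :
  (forall g, g \in SL -> model_rep g hw_vec \in W) -> W = fullv.
Proof.
move=> WO; have [hs [hsSL hsf hsx]] := free_generating_family (fun g => model_rep g hw_vec) SL.
have hsW : (<<[seq model_rep g hw_vec | g <- hs]>> <= W)%VS.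
  by apply/span_subvP => u /mapP[g /hsSL gSL ->]; apply: WO.
suff spanE : <<[seq model_rep g hw_vec | g <- hs]>>%VS = fullv.
  by apply/eqP; rewrite eqEsubv subvf -spanE.
pose X := map_tuple (fun g => model_rep g hw_vec) (in_tuple hs).
pose L (w : V) : 'rV[C]_(size hs) := \row_i fischer (pol (tnth X i)) (pol w).
have Llin : linear L.
  move=> c u w; apply/rowP => i; rewrite !mxE !linearP.
  by rewrite /GRing.scale.
pose Lm := GRing.isLinear.Build C V 'rV[C]_(size hs) _ L Llin.
pose Lf : {linear V -> 'rV[C]_(size hs)} := HB.pack L Lm.
pose W1 := lker (linfun Lf).
have memW1 w : w \in W1 -> forall u, u \in <<X>>%VS -> fischer (pol u) (pol w) = 0.
  rewrite memv_ker lfunE => /eqP Lw u /coord_span ->.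
  rewrite fischer_sym (linear_sum pol) linear_sum big1 // => i _ /=.
  rewrite [pol (_ *: _)]linearZ linearZ /= fischer_sym.
  have := congr1 (fun r : 'rV[C]_(size hs) => r 0 i) Lw; rewrite !mxE (tnth_nth 0) => ->.
  by rewrite scaler0.
(* The adjoint of the action of [A] is that of its transpose, again in SL, so it preserves the span
   of the orbit. *)
have W1inv A : A \in SL -> (model_rep A @: W1 <= W1)%VS.
  move=> ASL; apply/subvP => _ /memv_imgP[w wW1 ->]; rewrite memv_ker lfunE.
  apply/eqP/rowP => i; rewrite !mxE pol_rep fischer_pair_subst -pol_rep.
  apply: memW1 => //; rewrite tnth_map -(rep_mul model_is_rep).
  - apply: hsx; apply: SLM; last exact/hsSL/mem_tnth.
    by move: ASL; rewrite !inE det_tr.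
  - by move: ASL; rewrite !inE det_tr.
  - exact/hsSL/mem_tnth.
have W10 : W1 = 0%VS.
  apply/eqP/negPn/negP => /(invariant_contains_hw W1inv) hwW1.
  have hwX : hw_vec \in <<X>>%VS by rewrite -[hw_vec](rep_one model_is_rep); apply/hsx/SL1.
  by have /eqP := memW1 _ hwW1 _ hwX; rewrite pol_hw; apply/negP;
     apply/fischer_neq0/hw_poly_neq0/hw_poly_real.
(* Pairing with the free family is injective, so its length bounds the dimension of [V]. *)
apply/eqP; rewrite eqEdim subvf /= (eqP (hsf : \dim _ == _)) size_map.
have := limg_ker_dim (linfun Lf) fullv; rewrite capfv -/W1 W10 dimv0 add0n => <-.
by apply: leq_trans (dimvS (subvf _)) _; rewrite dimvf /dim /= mul1n.
Qed.

Lemma model_irreducible : irreducible_rep model_rep.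
Proof.
split; first exact: model_is_rep.
  apply: contraNneq hw_vec_neq0 => h; have := memvf hw_vec.
  by rewrite h memv0.
move=> W Winv; have [->|W0] := eqVneq W 0%VS; [by left | right].
apply: hw_orbit_generates => g gSL; apply: invariant_rep => //.
exact: invariant_contains_hw.
Qed.

Lemma dimL_two_rows (lam : 'rV[int]_m) :
  lam 0 i0 = p%:Z -> lam 0 i1 = q%:Z -> (forall i : 'I_m, (1 < i)%N -> lam 0 i = 0) ->
  (dimL R lam + (0 < q) * ('C(p + k.+2, p.+1) * 'C(q + k, q.-1)) =
   'C(p + k.+1, p) * 'C(q + k.+1, q))%N.
Proof.
move=> lam0 lam1 lam2.
rewrite (dimL_eq model_irreducible (model_highest_weight lam0 lam1 lam2)).
rewrite -[RHS]size_bimonomials -[RHS](dim_model_space C m qp) dimvf /dim /=.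
congr (_ + _)%N; case: posnP => // q0; rewrite size_bimonomials addSnnS.
by have -> : (q.-1 + k.+1 = q + k)%N by lia.
Qed.
End Model.

(** * Dimension formula *)

(** For [q <= p], Weyl's dimension formula for the partition (p, q) and SL(k + 2). *)
Definition two_row_dim (k p q : nat) : rat :=
  (p.+1%:R - q%:R) / p.+1%:R * 'C(p + k.+1, p)%:R * 'C(q + k, q)%:R.

Lemma bin_addSr d j : j.+1%:R * 'C(d + j.+1, d)%:R = (d + j).+1%:R * 'C(d + j, d)%:R :> rat.
Proof.
have sym i : 'C(d + i, d) = 'C(d + i, i) by rewrite -(bin_sub (leq_addr i d)) addKn.
by rewrite -!natrM !sym addnS -mul_bin_diag.
Qed.

Lemma bin_addSl d j : d.+1%:R * 'C(d.+1 + j, d.+1)%:R = (d + j).+1%:R * 'C(d + j, d)%:R :> rat.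
Proof. by rewrite -!natrM addSn -mul_bin_diag. Qed.

Lemma two_row_dim0 p q : two_row_dim 0 p q = p.+1%:R - q%:R.
Proof. by rewrite /two_row_dim addn0 addn1 binn binSn mulr1 mulfVK ?pnatr_eq0. Qed.

(** Only the two binomials depend on [k]; their successive ratios are the two factors. *)
Lemma two_row_dimS k p q : two_row_dim k.+1 p q =
  (1 + q%:R / k.+1%:R) * (1 + p%:R / k.+2%:R) * two_row_dim k p q.
Proof.
rewrite /two_row_dim.
have : 'C(p + k.+2, p)%:R = (p + k.+1).+1%:R * 'C(p + k.+1, p)%:R / k.+2%:R :> rat.
  by rewrite -bin_addSr mulrC mulKf ?pnatr_eq0.
have : 'C(q + k.+1, q)%:R = (q + k).+1%:R * 'C(q + k, q)%:R / k.+1%:R :> rat.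
  by rewrite -bin_addSr mulrC mulKf ?pnatr_eq0.
move=> -> ->; move: ('C(p + k.+1, p)%:R) ('C(q + k, q)%:R) => P Q.
rewrite -!natr1 !natrD -!natr1; field.
by rewrite !natr1 !pnatr_eq0.
Qed.

(** The 2 by 2 determinant h_p h_q - h_(p+1) h_(q-1), with h_(-1) = 0 accounting for [(0 < q)]; all
    binomials are reduced to two common ones. *)
Lemma two_row_dim_jacobi_trudi k p q : two_row_dim k p q =
  'C(p + k.+1, p)%:R * 'C(q + k.+1, q)%:R -
  ((0 < q) * ('C(p + k.+2, p.+1) * 'C(q + k, q.-1)))%N%:R.
Proof.
case: q => [|q].
  by rewrite /two_row_dim mul0n !subr0 !bin0 divff ?pnatr_eq0 // mul1r.
rewrite mul1n natrM /two_row_dim /=.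
have : 'C(p + k.+2, p.+1)%:R = (p + k.+1).+1%:R * 'C(p + k.+1, p)%:R / p.+1%:R :> rat.
  by rewrite -addSnnS -bin_addSl mulrC mulKf ?pnatr_eq0.
have : 'C(q.+1 + k.+1, q.+1)%:R = (q.+1 + k).+1%:R * 'C(q.+1 + k, q.+1)%:R / k.+1%:R :> rat.
  by rewrite -bin_addSr mulrC mulKf ?pnatr_eq0.
have : 'C(q.+1 + k, q)%:R = q.+1%:R * 'C(q.+1 + k, q.+1)%:R / k.+1%:R :> rat.
  rewrite -natrM mul_bin_left natrM (_ : (q.+1 + k - q = k.+1)%N); last by lia.
  by rewrite mulrC mulKf ?pnatr_eq0.
move=> -> -> ->; move: ('C(p + k.+1, p)%:R) ('C(q.+1 + k, q.+1)%:R) => P Q.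
rewrite -!natr1 !natrD -!natr1; field.
by rewrite !natr1 !pnatr_eq0.
Qed.

Lemma omega_sum_entry m a b (i : 'I_m) :
  (omega m 1 *+ a + omega m 2 *+ b) 0 i = (((i < 1 < m) * a + (i < 2 < m) * b)%N)%:Z.
Proof.
by rewrite mxE !mulmxnE !mxE PoszD !PoszM -[X in X + _]mulr_natr -[X in _ + X]mulr_natr !natz.
Qed.

Lemma HS_two_row_dim (R : realType) k a b :
  HS R k.+2 a b = two_row_dim k (2 * a + 2 * b) (2 * b).
Proof.
(* For SL(2) the convention [omega 2 = 0] leaves the weight (2a, 0); the formula is unaffected,
   since [two_row_dim 0] depends only on the difference of its arguments. *)
pose p := if k is 0 then (2 * a)%N else (2 * a + 2 * b)%N.
pose q := if k is 0 then 0%N else (2 * b)%N.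
have -> : two_row_dim k (2 * a + 2 * b) (2 * b) = two_row_dim k p q.
  rewrite /p /q; case: k {p q} => //.
  by rewrite !two_row_dim0 -!natr1 natrD; ring.
have qp : (q <= p)%N by rewrite /p /q; case: (k) => //= *; rewrite leq_addl.
rewrite two_row_dim_jacobi_trudi /HS; apply/eqP.
rewrite eq_sym subr_eq -!natrM -natrD eqr_nat eq_sym.
apply/eqP/dimL_two_rows => //.
- by rewrite omega_sum_entry /p; case: (k) => [|k'] /=; congr Posz; rewrite ?mul1n ?mul0n ?addn0.
- by rewrite omega_sum_entry /q; case: (k) => [|k'] /=; congr Posz; rewrite ?mul1n ?mul0n ?addn0.
- by move=> i i1; rewrite omega_sum_entry; rewrite (leq_gtF (ltnW i1)) (leq_gtF i1).
Qed.

Theorem mainTheorem2 (R : realType) (n : nat) (hn : (3 <= n)%N) :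
  let D1 (F : fps2) : fps2 :=
    (F + (2 / (n%:R - 1)) *: mulq1 (dq1 F)
       + (2 / (n%:R - 1)) *: mulq2 (dq2 F))%fps2 in
  let D2 (F : fps2) : fps2 :=
    (F + (2 / (n%:R - 2)) *: mulq2 (dq2 F))%fps2 in
  HS R n = D2 (D1 (HS R n.-1)).
Proof.
case: n hn => [|[|[|k]]] // _ D1 D2.
have euler1 (F : fps2) a b : mulq1 (dq1 F) a b = a%:R * F a b.
  by case: a => [|a]; rewrite /mulq1 /dq1 ?mul0r.
have euler2 (F : fps2) a b : mulq2 (dq2 F) a b = b%:R * F a b.
  by case: b => [|b]; rewrite /mulq2 /dq2 ?mul0r.
apply: boolp.funext => a; apply: boolp.funext => b.
(* On the coefficient at (a, b) the operators multiply by 1 + 2(a + b)/(k + 2) and 1 + 2b/(k + 1),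
   the factors of [two_row_dimS] for p = 2a + 2b and q = 2b. *)
rewrite /D2 /D1 -[k.+3.-1]/k.+2 /fps2_add /fps2_scale !(euler1, euler2)
   !HS_two_row_dim two_row_dimS.
move: (two_row_dim _ _ _) => d.
have -> : k.+3%:R - 1 = k.+2%:R :> rat by rewrite -[k.+3%:R]natr1 addrK.
have -> : k.+3%:R - 2 = k.+1%:R :> rat by rewrite -(natrB _ (ltn0Sn k.+1 : 2 <= k.+3)%N) subn2.
have : k.+1%:R != 0 :> rat by rewrite pnatr_eq0.
have : k.+2%:R != 0 :> rat by rewrite pnatr_eq0.
move: k.+1%:R k.+2%:R => u v v0 u0.
by rewrite natrD !natrM; field; rewrite u0 v0.
Qed.
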